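(* Let $n\ge 1$ and let $X=C_n$ be the directed cycle graph with $n$ vertices. Then $\mathcal{BF}(X)$ is infinite and the defect is $\delta(X)=0$. Fix a prime $p$ and let $X_m$ denote the $m$-th layer of the constant $\mathbb{Z}_p$-tower of $X$. Then $\delta(X_m)=0$. Moreover, the Iwasawa invariants of the tower are $\mu_p(\mathcal{BF}(X_\infty))=0$ and $\lambda_p(\mathcal{BF}(X_\infty))=1$.
   Context: A digraph $X$ has a vertex set $V(X)$ and a set $E(X)$ of directed edges (loops and multiple edges allowed), each edge $e$ having an origin $o(e)$ and a terminus $t(e)$. The directed cycle graph $C_n$ is the Cayley graph of a cyclic group of order $n$ with respect to a single generator $g$: vertices $g^i$ and one edge from $g^i$ to $g^{i+1}$ for each $i\in\mathbb{Z}/n\mathbb{Z}$. Constant tower: for a finite connected digraph $X$ and a prime $p$, let $\Gamma\simeq\mathbb{Z}_p$ (written multiplicatively) have topological generator $\theta$, and let $\theta_m$ be the image of $\theta$ in $\Gamma/\Gamma^{p^m}\simeq\mathbb{Z}/p^m\mathbb{Z}$. The layer $X_m$ has vertex set $V(X)\times\Gamma/\Gamma^{p^m}$, edge set $E(X)\times\Gamma/\Gamma^{p^m}$, and the edge $(e,g)$ goes from $(o(e),g)$ to $(t(e),g\theta_m)$. The number of connected components of $X_m$ stabilizes; let $m_0$ be the minimal index at which it does (then $X_{m_0}$ consists of $p^{m_0}$ copies of $X$; for $X=C_n$ one has $m_0=\operatorname{val}_p(n)$). For the Iwasawa invariants, when the layers are not connected the convention is to restrict to one component: fix a connected component $X'_{m_0}\cong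 X$ of $X_{m_0}$, and for $m\ge m_0$ let $X'_m$ be the unique connected component of $X_m$ above it; $X'_m/X'_{m_0}$ is Galois with group $\Gamma^{p^{m_0}}/\Gamma^{p^m}\simeq\mathbb{Z}/p^{m-m_0}\mathbb{Z}$. Let $\Gamma'=\Gamma^{p^{m_0}}\simeq\mathbb{Z}_p$ be the resulting Galois group. Bowen--Franks group and defect: for a finite digraph $Y$, $\operatorname{Div}(Y)$ is the free abelian group on $V(Y)$, the adjacency operator $A_Y$ sends $v$ to $\sum_{e:\,o(e)=v}t(e)$, and $\mathcal{BF}(Y)=\operatorname{Div}(Y)/(\mathrm{Id}-A_Y)\operatorname{Div}(Y)$. The defect is $\delta(Y)=a(Y)-b(Y)$, where $a(Y)$ and $b(Y)$ are respectively the algebraic and the geometric multiplicity of $1$ as an eigenvalue of $A_Y$. Put $\mathcal{BF}(X_\infty)=\varprojlim_{m\ge m_0}\mathcal{BF}(X'_m)\otimes\mathbb{Z}_p$ (transition maps induced by the projections on vertices), a finitely generated module over $\Lambda=\mathbb{Z}_p\llbracket\Gamma'\rrbracket\simeq\mathbb{Z}_p\llbracket T\rrbracket$ (a topological generator of $\Gamma'$ mapping to $1+T$). Iwasawa invariants: a finitely generated torsion $\Lambda$-module $M$ is pseudo-isomorphic (finite kernel and cokernel) to $\bigoplus_{i}\Lambda/(p^{m_i})\oplus\bigoplus_j\Lambda/(f_j(T))$ with $m_i>0$ and $f_j$ distinguished polynomials (monic, non-leading coefficients divisible by $p$); then $\mu_p(M)=\sum_i m_i$ and $\lambda_p(M)=\sum_j\deg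 f_j$. *)

(* Defs.v *)
From HB Require Import structures.
From mathcomp Require Import all_boot all_order all_algebra.
From mathcomp Require Import generic_quotient ring_quotient finmap monalg.
From mathcomp Require Import boolp classical_sets functions cardinality.

Set Implicit Arguments.
Unset Strict Implicit.
Unset Printing Implicit Defensive.

Import GRing.Theory.
Local Open Scope ring_scope.
Local Open Scope quotient_scope.

Record submodule (R : nzRingType) (V : lmodType R) := Submodule {
  submod_pred :> {pred V};
  submodP : submod_closed submod_pred
}.

HB.instance Definition _ (R : nzRingType) (V : lmodType R) (S : submodule V) :=
  GRing.isSubmodClosed.Build R V (submod_pred S)
    (GRing.submod_closed_semi (submodP S)).

Section Submodules.
Variables (R : nzRingType).

Section Span.
Variables (V : lmodType R) (A : V -> Prop).

Definition span_pred : {pred V} := fun v =>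
  `[< forall P : V -> Prop, P 0 ->
      (forall (a : R) u w, P u -> P w -> P (a *: u + w)) ->
      (forall u, A u -> P u) -> P v >].

Fact span_submod_closed : submod_closed span_pred.
Proof.
split; [by apply/asboolP => P P0 _ _|].
move=> a u v /asboolP hu /asboolP hv; apply/asboolP => P P0 PD PA.
by apply: (PD); [exact: hu P P0 PD PA | exact: hv P P0 PD PA].
Qed.
Definition span := Submodule span_submod_closed.

Lemma mem_span v : A v -> v \in span.
Proof. by move=> Av; apply/asboolP => P _ _; apply. Qed.

Lemma span_sub (S : submodule V) : (forall v, A v -> v \in S) -> {subset span <= S}.
Proof.
move=> AS v /asboolP/(_ (fun u => u \in S)); apply=> //; first exact: rpred0.
by move=> a u w uS wS; rewrite rpredD // rpredZ.
Qed.
End Span.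

Section Image.
Variables (U V : lmodType R) (f : {linear U -> V}).

Definition img_pred : {pred V} := fun v => `[< exists u, f u = v >].

Fact img_submod_closed : submod_closed img_pred.
Proof.
split; [by apply/asboolP; exists 0; rewrite linear0|].
move=> a u v /asboolP[x <-] /asboolP[y <-]; apply/asboolP.
by exists (a *: x + y); rewrite linearP.
Qed.
Definition img := Submodule img_submod_closed.
End Image.

Section QuotientModule.
Variables (V : lmodType R) (S : submodule V).

Definition qmod : Type := {ideal_quot S}.
HB.instance Definition _ := GRing.Zmodule.on qmod.

Definition qproj (v : V) : qmod := \pi_{ideal_quot S} v.
Definition qrepr (x : qmod) : V := repr (x : {ideal_quot S}).

Lemma qreprK : cancel qrepr qproj.
Proof. by move=> x; rewrite /qproj /qrepr reprK. Qed.

Lemma qprojP u v : qproj u = qproj v <-> u - v \in S.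
Proof.
rewrite (Quotient.idealrBE S u v); split=> [h|/eqP //].
by apply/eqP.
Qed.

Lemma qproj_eq0 v : qproj v = 0 <-> v \in S.
Proof.
have -> : (0 : qmod) = qproj 0 by rewrite /qproj raddf0.
by rewrite qprojP subr0.
Qed.

Fact qprojB : {morph qproj : u v / u - v}.
Proof. by move=> u v; rewrite /qproj raddfB. Qed.

Definition qscale (a : R) (x : qmod) : qmod := qproj (a *: qrepr x).

Lemma qscale_proj a v : qscale a (qproj v) = qproj (a *: v).
Proof.
apply/qprojP; rewrite -scalerBr rpredZ //; apply/qprojP.
by rewrite qreprK.
Qed.

Fact qprojD : {morph qproj : u v / u + v}.
Proof. by move=> u v; rewrite /qproj raddfD. Qed.

Fact qscaleA a b x : qscale a (qscale b x) = qscale (a * b) x.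
Proof. by rewrite -[x]qreprK !qscale_proj scalerA. Qed.
Fact qscale1 : left_id 1 qscale.
Proof. by move=> x; rewrite -[x]qreprK !qscale_proj scale1r. Qed.
Fact qscaleDr : right_distributive qscale +%R.
Proof.
by move=> a x y; rewrite -[x]qreprK -[y]qreprK !(qscale_proj, =^~ qprojD) scalerDr.
Qed.
Fact qscaleDl x : {morph qscale^~ x : a b / a + b}.
Proof.
by move=> a b; rewrite -[x]qreprK !(qscale_proj, =^~ qprojD) scalerDl.
Qed.
HB.instance Definition _ :=
  GRing.Zmodule_isLmodule.Build R qmod qscaleA qscale1 qscaleDr qscaleDl.

HB.instance Definition _ := GRing.isZmodMorphism.Build V qmod qproj qprojB.
Fact qproj_scalable : scalable qproj.
Proof. by move=> a v; rewrite -qscale_proj. Qed.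
HB.instance Definition _ := GRing.isScalable.Build R V qmod *:%R qproj qproj_scalable.

Section Lift.
Variables (W : lmodType R) (f : {linear V -> W}) (fS : {in S, forall v, f v = 0}).

Definition qlift of {in S, forall v, f v = 0} : qmod -> W := fun x => f (qrepr x).

Lemma qlift_proj v : qlift fS (qproj v) = f v.
Proof.
apply/eqP; rewrite -subr_eq0 -linearB fS //.
by apply/qprojP; rewrite qreprK.
Qed.

Fact qlift_linear : linear (qlift fS).
Proof.
move=> a x y; rewrite -[x]qreprK -[y]qreprK -linearP !qlift_proj.
by rewrite linearP.
Qed.
HB.instance Definition _ := GRing.isLinear.Build R qmod W *:%R (qlift fS) qlift_linear.
End Lift.

End QuotientModule.
End Submodules.
Arguments qproj {R V S}.

Section LiftTheory.
Variables (R : nzRingType) (V W : lmodType R) (S : submodule V).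

Lemma qmod_ext (f g : qmod S -> W) :
  (forall v, f (qproj v) = g (qproj v)) -> f =1 g.
Proof. by move=> fg x; rewrite -[x]qreprK. Qed.

End LiftTheory.

Section DirectSum.
Variables (R : nzRingType) (I : finType) (M : I -> lmodType R).

Definition dsum : Type := forall i, M i.

HB.instance Definition _ := gen_eqMixin dsum.
HB.instance Definition _ := gen_choiceMixin dsum.

Let add (x y : dsum) : dsum := fun i => x i + y i.
Let opp (x : dsum) : dsum := fun i => - x i.
Let zero : dsum := fun i => 0.
Let scale a (x : dsum) : dsum := fun i => a *: x i.

Fact dsum_addA : associative add.
Proof. by move=> x y z; apply: functional_extensionality_dep => i; exact: addrA. Qed.
Fact dsum_addC : commutative add.
Proof. by move=> x y; apply: functional_extensionality_dep => i; exact: addrC. Qed.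
Fact dsum_add0 : left_id zero add.
Proof. by move=> x; apply: functional_extensionality_dep => i; exact: add0r. Qed.
Fact dsum_addN : left_inverse zero opp add.
Proof. by move=> x; apply: functional_extensionality_dep => i; exact: addNr. Qed.
HB.instance Definition _ :=
  GRing.isZmodule.Build dsum dsum_addA dsum_addC dsum_add0 dsum_addN.

Fact dsum_scaleA a b x : scale a (scale b x) = scale (a * b) x.
Proof. by apply: functional_extensionality_dep => i; exact: scalerA. Qed.
Fact dsum_scale1 : left_id 1 scale.
Proof. by move=> x; apply: functional_extensionality_dep => i; exact: scale1r. Qed.
Fact dsum_scaleDr : right_distributive scale +%R.
Proof. by move=> a x y; apply: functional_extensionality_dep => i; exact: scalerDr. Qed.
Fact dsum_scaleDl x : {morph scale^~ x : a b / a + b}.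
Proof. by move=> a b; apply: functional_extensionality_dep => i; exact: scalerDl. Qed.
HB.instance Definition _ :=
  GRing.Zmodule_isLmodule.Build R dsum dsum_scaleA dsum_scale1 dsum_scaleDr dsum_scaleDl.

End DirectSum.

Section RingLimit.
Variables (R : nat -> comNzRingType) (f : forall k, {rmorphism R k.+1 -> R k}).

Record rlim := RLim {
  rlim_val :> forall k, R k;
  rlimP : forall k, f k (rlim_val k.+1) = rlim_val k
}.

HB.instance Definition _ := gen_eqMixin rlim.
HB.instance Definition _ := gen_choiceMixin rlim.

Lemma rlim_ext (x y : rlim) : (forall k, x k = y k) -> x = y.
Proof.
case: x y => [x xP] [y yP] /= xy.
have {}xy : x = y by apply: functional_extensionality_dep.
by rewrite {}xy in xP *; congr RLim; apply: Prop_irrelevance.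
Qed.

Definition rlim_zero : rlim := @RLim (fun k => 0) (fun k => rmorph0 (f k)).
Definition rlim_one : rlim := @RLim (fun k => 1) (fun k => rmorph1 (f k)).
Fact rlim_addP (x y : rlim) k : f k (x k.+1 + y k.+1) = x k + y k.
Proof. by rewrite rmorphD !rlimP. Qed.
Fact rlim_oppP (x : rlim) k : f k (- x k.+1) = - x k.
Proof. by rewrite rmorphN !rlimP. Qed.
Fact rlim_mulP (x y : rlim) k : f k (x k.+1 * y k.+1) = x k * y k.
Proof. by rewrite rmorphM !rlimP. Qed.
Definition rlim_add x y : rlim := RLim (rlim_addP x y).
Definition rlim_opp x : rlim := RLim (rlim_oppP x).
Definition rlim_mul x y : rlim := RLim (rlim_mulP x y).

Fact rlim_addA : associative rlim_add.
Proof. by move=> x y z; apply: rlim_ext => k; exact: addrA. Qed.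
Fact rlim_addC : commutative rlim_add.
Proof. by move=> x y; apply: rlim_ext => k; exact: addrC. Qed.
Fact rlim_add0 : left_id rlim_zero rlim_add.
Proof. by move=> x; apply: rlim_ext => k; exact: add0r. Qed.
Fact rlim_addN : left_inverse rlim_zero rlim_opp rlim_add.
Proof. by move=> x; apply: rlim_ext => k; exact: addNr. Qed.
HB.instance Definition _ :=
  GRing.isZmodule.Build rlim rlim_addA rlim_addC rlim_add0 rlim_addN.

Fact rlim_mulA : associative rlim_mul.
Proof. by move=> x y z; apply: rlim_ext => k; exact: mulrA. Qed.
Fact rlim_mulC : commutative rlim_mul.
Proof. by move=> x y; apply: rlim_ext => k; exact: mulrC. Qed.
Fact rlim_mul1 : left_id rlim_one rlim_mul.
Proof. by move=> x; apply: rlim_ext => k; exact: mul1r. Qed.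
Fact rlim_mulDl : left_distributive rlim_mul +%R.
Proof. by move=> x y z; apply: rlim_ext => k; exact: mulrDl. Qed.
Fact rlim_one_neq0 : rlim_one != 0.
Proof.
apply/eqP => /(congr1 (fun x : rlim => x 0%N)) h; have /eqP := oner_neq0 (R 0%N).
by apply; exact: h.
Qed.
HB.instance Definition _ := GRing.Zmodule_isComNzRing.Build rlim
  rlim_mulA rlim_mulC rlim_mul1 rlim_mulDl rlim_one_neq0.

End RingLimit.

Section ModuleLimit.
Variables (R : nat -> comNzRingType) (f : forall k, {rmorphism R k.+1 -> R k}).
Variables (M : forall k, lmodType (R k)).
Variables (g : forall k, {additive M k.+1 -> M k}).

(* The semilinearity of the transition maps is a parameter of the type of the
   limit so that the module structure below can be inferred from the type. *)
Record mlim (gZ : forall k (a : R k.+1) x, g k (a *: x) = f k a *: g k x) := MLim {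
  mlim_val :> forall k, M k;
  mlimP : forall k, g k (mlim_val k.+1) = mlim_val k
}.

Hypothesis gZ : forall k (a : R k.+1) x, g k (a *: x) = f k a *: g k x.
Local Notation L := (mlim gZ).

HB.instance Definition _ := gen_eqMixin L.
HB.instance Definition _ := gen_choiceMixin L.

Lemma mlim_ext (x y : L) : (forall k, x k = y k) -> x = y.
Proof.
case: x y => [x xP] [y yP] /= xy.
have {}xy : x = y by apply: functional_extensionality_dep.
by rewrite {}xy in xP *; congr (MLim gZ); apply: Prop_irrelevance.
Qed.

Definition mlim_zero : L := @MLim gZ (fun k => 0) (fun k => raddf0 (g k)).
Fact mlim_addP (x y : L) k : g k (x k.+1 + y k.+1) = x k + y k.
Proof. by rewrite raddfD !mlimP. Qed.
Fact mlim_oppP (x : L) k : g k (- x k.+1) = - x k.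
Proof. by rewrite raddfN !mlimP. Qed.
Fact mlim_scaleP (a : rlim f) (x : L) k : g k (a k.+1 *: x k.+1) = a k *: x k.
Proof. by rewrite gZ mlimP rlimP. Qed.
Definition mlim_add x y : L := MLim gZ (mlim_addP x y).
Definition mlim_opp x : L := MLim gZ (mlim_oppP x).
Definition mlim_scale a x : L := MLim gZ (mlim_scaleP a x).

Fact mlim_addA : associative mlim_add.
Proof. by move=> x y z; apply: mlim_ext => k; exact: addrA. Qed.
Fact mlim_addC : commutative mlim_add.
Proof. by move=> x y; apply: mlim_ext => k; exact: addrC. Qed.
Fact mlim_add0 : left_id mlim_zero mlim_add.
Proof. by move=> x; apply: mlim_ext => k; exact: add0r. Qed.
Fact mlim_addN : left_inverse mlim_zero mlim_opp mlim_add.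
Proof. by move=> x; apply: mlim_ext => k; exact: addNr. Qed.
HB.instance Definition _ :=
  GRing.isZmodule.Build L mlim_addA mlim_addC mlim_add0 mlim_addN.

Fact mlim_scaleA a b x : mlim_scale a (mlim_scale b x) = mlim_scale (a * b) x.
Proof. by apply: mlim_ext => k; exact: scalerA. Qed.
Fact mlim_scale1 : left_id 1 mlim_scale.
Proof. by move=> x; apply: mlim_ext => k; exact: scale1r. Qed.
Fact mlim_scaleDr : right_distributive mlim_scale +%R.
Proof. by move=> a x y; apply: mlim_ext => k; exact: scalerDr. Qed.
Fact mlim_scaleDl x : {morph mlim_scale^~ x : a b / a + b}.
Proof. by move=> a b; apply: mlim_ext => k; exact: scalerDl. Qed.
HB.instance Definition _ := GRing.Zmodule_isLmodule.Build (rlim f) L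
  mlim_scaleA mlim_scale1 mlim_scaleDr mlim_scaleDl.

End ModuleLimit.

Section Padic.
Variable p : nat.

(* ['Z_n] is [Z/nZ] only for [n > 1], hence the exponent [k.+1]; this does not
   change the limit. *)
Definition padic_red k (x : 'Z_(p ^ k.+2)) : 'Z_(p ^ k.+1) := inZp x.

Fact padic_red_dvd k : ((Zp_trunc (p ^ k.+1)).+2 %| (Zp_trunc (p ^ k.+2)).+2)%N.
Proof.
case: p => [|[|q]]; [by rewrite !exp0n | by rewrite !exp1n |].
by rewrite !Zp_cast ?dvdn_exp2l // -[1%N](expn0 q.+2) ltn_exp2l.
Qed.

Fact padic_red_nmod k : nmod_morphism (@padic_red k).
Proof.
split=> [|x y]; apply: val_inj => /=; first by rewrite mod0n.
by rewrite (modn_dvdm _ (padic_red_dvd k)) modnDm.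
Qed.
Fact padic_red_monoid k : monoid_morphism (@padic_red k).
Proof.
split=> [|x y]; apply: val_inj => //=.
by rewrite (modn_dvdm _ (padic_red_dvd k)) modnMm.
Qed.
HB.instance Definition _ k := GRing.isNmodMorphism.Build _ _ (@padic_red k) (padic_red_nmod k).
HB.instance Definition _ k := GRing.isMonoidMorphism.Build _ _ (@padic_red k) (padic_red_monoid k).

Definition padic : Type := @rlim (fun k => 'Z_(p ^ k.+1)) (fun k => @padic_red k).
HB.instance Definition _ := GRing.ComNzRing.on padic.

End Padic.

Section GroupRing.
Variables (R : comNzRingType) (G : finZmodType).

Definition grpring : Type := {ffun G -> R}.
HB.instance Definition _ := GRing.Zmodule.on grpring.

Definition gr_mul (a b : grpring) : grpring := [ffun g => \sum_h a h * b (g - h)].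
Definition gr_const (r : R) : grpring := [ffun g => if g == 0 then r else 0].
Definition gr_base (g0 : G) : grpring := [ffun g => (g == g0)%:R].

Fact gr_mulC : commutative gr_mul.
Proof.
move=> a b; apply/ffunP => g; rewrite !ffunE.
rewrite (reindex_inj (subrI g)) /=; apply: eq_bigr => h _.
by rewrite subKr mulrC.
Qed.

Fact gr_mulA : associative gr_mul.
Proof.
move=> a b c; apply/ffunP => g; rewrite !ffunE.
under eq_bigr do rewrite ffunE mulr_sumr.
under [RHS]eq_bigr do rewrite ffunE mulr_suml.
rewrite [RHS]exchange_big /=; apply: eq_bigr => h _.
rewrite [RHS](reindex_inj (addrI h)) /=; apply: eq_bigr => k _.
by rewrite mulrA opprD addrA [h + k]addrC addrK.
Qed.

Fact gr_mul1 : left_id (gr_const 1) gr_mul.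
Proof.
move=> a; apply/ffunP => g; rewrite !ffunE (bigD1 0) //= !ffunE eqxx mul1r subr0.
by rewrite big1 ?addr0 // => h /negPf h0; rewrite ffunE h0 mul0r.
Qed.

Fact gr_mulDl : left_distributive gr_mul +%R.
Proof.
move=> a b c; apply/ffunP => g; rewrite !ffunE -big_split; apply: eq_bigr => h _.
by rewrite ffunE mulrDl.
Qed.

Fact gr_one_neq0 : gr_const 1 != 0.
Proof. by apply/eqP => /ffunP/(_ 0)/eqP; rewrite !ffunE eqxx oner_eq0. Qed.

HB.instance Definition _ := GRing.Zmodule_isComNzRing.Build grpring
  gr_mulA gr_mulC gr_mul1 gr_mulDl gr_one_neq0.

Fact gr_const_zmod : zmod_morphism gr_const.
Proof. by move=> r s; apply/ffunP => g; rewrite !ffunE; case: eqP; rewrite ?subr0. Qed.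
Fact gr_const_monoid : monoid_morphism gr_const.
Proof.
split=> // r s; apply/ffunP => g; rewrite !ffunE (bigD1 0) //= big1 => [|h /negPf h0].
  by rewrite !ffunE eqxx subr0 addr0; case: eqP; rewrite ?mulr0.
by rewrite !ffunE h0 mul0r.
Qed.
HB.instance Definition _ := GRing.isZmodMorphism.Build R grpring gr_const gr_const_zmod.
HB.instance Definition _ := GRing.isMonoidMorphism.Build R grpring gr_const gr_const_monoid.

End GroupRing.

Section GroupRingMap.
Variables (R : comNzRingType) (G H : finZmodType) (phi : {additive G -> H}).

Definition gr_map (a : grpring R G) : grpring R H :=
  [ffun h => \sum_(g | phi g == h) a g].

Fact gr_map_zmod : zmod_morphism gr_map.
Proof.
move=> a b; apply/ffunP => h; rewrite !ffunE -sumrB.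
by apply: eq_bigr => g _; rewrite !ffunE.
Qed.

Fact gr_map_monoid : monoid_morphism gr_map.
Proof.
split=> [|a b]; apply/ffunP => h; rewrite !ffunE.
  rewrite big_mkcond (bigD1 0) //= big1 => [|g /negPf g0]; rewrite ffunE.
    by rewrite eqxx addr0 raddf0 eq_sym.
  by rewrite g0 if_same.
under eq_bigr do rewrite ffunE.
rewrite exchange_big /=.
under [RHS]eq_bigr do rewrite !ffunE mulr_suml.
rewrite [RHS](exchange_big_dep xpredT) //=; apply: eq_bigr => g _.
rewrite (big_pred1 (phi g)) => [|k]; last by rewrite eq_sym.
rewrite mulr_sumr (reindex_inj (addIr g)) /=; apply: eq_big => [k|k _].
  by rewrite raddfD [RHS]eq_sym subr_eq eq_sym.
by rewrite addrK.
Qed.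
HB.instance Definition _ :=
  GRing.isZmodMorphism.Build (grpring R G) (grpring R H) gr_map gr_map_zmod.
HB.instance Definition _ :=
  GRing.isMonoidMorphism.Build (grpring R G) (grpring R H) gr_map gr_map_monoid.

End GroupRingMap.

Section GroupAction.
Variables (R : comNzRingType) (G : finZmodType) (M : lmodType R).

Record linear_action := LinearAction {
  lact :> G -> {linear M -> M};
  lact0 : forall x, lact 0 x = x;
  lactD : forall g h x, lact (g + h) x = lact g (lact h x)
}.

Variable act : linear_action.

(* an alias of [M], carrying the induced structure of module over [R[G]] *)
Definition grmod of linear_action : Type := M.
Local Notation N := (grmod act).
HB.instance Definition _ := GRing.Zmodule.on N.

Definition gr_scale (a : grpring R G) (x : N) : N := \sum_g a g *: act g x.

Fact gr_scaleA a b x : gr_scale a (gr_scale b x) = gr_scale (a * b) x.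
Proof.
rewrite /gr_scale; under eq_bigr do rewrite linear_sum scaler_sumr.
under [RHS]eq_bigr do rewrite ffunE scaler_suml.
rewrite [RHS]exchange_big /=; apply: eq_bigr => g _.
rewrite [RHS](reindex_inj (addrI g)) /=; apply: eq_bigr => h _.
by rewrite linearZ /= scalerA lactD [g + h]addrC addrK.
Qed.
Fact gr_scale1 : left_id 1 gr_scale.
Proof.
move=> x; rewrite /gr_scale (bigD1 0) //= big1 ?addr0 => [|g /negPf g0].
  by rewrite ffunE eqxx lact0 scale1r.
by rewrite ffunE g0 scale0r.
Qed.
Fact gr_scaleDr : right_distributive gr_scale +%R.
Proof.
move=> a x y; rewrite /gr_scale -big_split; apply: eq_bigr => g _.
by rewrite linearD scalerDr.
Qed.
Fact gr_scaleDl x : {morph gr_scale^~ x : a b / a + b}.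
Proof.
move=> a b; rewrite /gr_scale -big_split; apply: eq_bigr => g _.
by rewrite ffunE scalerDl.
Qed.
HB.instance Definition _ := GRing.Zmodule_isLmodule.Build (grpring R G) N
  gr_scaleA gr_scale1 gr_scaleDr gr_scaleDl.

End GroupAction.

Section FreeModule.
Variables (R : nzRingType) (K : choiceType) (N : lmodType R) (h : K -> N).

Definition malg_ext (v : {malg R[K]}) : N := \sum_(k <- msupp v) v@_k *: h k.

Lemma malg_extEw (d : {fset K}) v : (msupp v `<=` d)%fset ->
  malg_ext v = \sum_(k <- d) v@_k *: h k.
Proof.
move=> le; rewrite [LHS](big_fset_incl _ le) => //= x xd /mcoeff_outdom ->.
by rewrite scale0r.
Qed.

Lemma malg_extU r k : malg_ext << r *g k >> = r *: h k.
Proof. by rewrite (malg_extEw msuppU_le) big_seq_fset1 mcoeffUU. Qed.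

Fact malg_ext_linear : linear malg_ext.
Proof.
move=> a u v; pose d := (msupp u `|` msupp v `|` msupp (a *: u + v))%fset.
rewrite !(malg_extEw (d := d)) /d ?fsubsetUr //.
  by rewrite scaler_sumr -big_split; apply: eq_bigr => k _;
     rewrite mcoeffD mcoeffZ scalerDl scalerA.
all: by apply/fsubsetP => k kd; rewrite !in_fsetU kd ?orbT.
Qed.
HB.instance Definition _ :=
  GRing.isLinear.Build R {malg R[K]} N *:%R malg_ext malg_ext_linear.

End FreeModule.

Section Scalars.
Variables (R : comNzRingType).

Section Object.
Variable M : zmodType.

Definition scalars_rel (v : {malg R[M]}) : Prop :=
  exists x y : M, v = << x + y >> - << x >> - << y >>.

(* [M \otimes_Z R], generated as an [R]-module by the [x \otimes 1] subject to
   additivity in [x]; [scalars_lift] below is its universal property. *)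
Definition scalars : Type := qmod (span scalars_rel).
HB.instance Definition _ := GRing.Lmodule.on scalars.

Definition tens (x : M) (r : R) : scalars := qproj << r *g x >>.

Lemma tensZ x a r : tens x (a * r) = a *: tens x r.
Proof.
rewrite /tens -linearZ; congr qproj; apply/malgP => y.
by rewrite mcoeffZ !mcoeffU mulrnAr.
Qed.

Lemma tensDr x : {morph tens x : r s / r + s}.
Proof. by move=> r s; rewrite /tens monalgUD linearD. Qed.

Lemma tensDl r : {morph tens^~ r : x y / x + y}.
Proof.
have t1 x : tens x r = r *: tens x 1 by rewrite -tensZ mulr1.
move=> x y; rewrite !t1 -scalerDr; congr (_ *: _).
rewrite /tens -linearD; apply/qprojP/mem_span; exists x, y.
by rewrite opprD addrA.
Qed.

Fact tens1_nmod : nmod_morphism (tens^~ 1).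
Proof.
split=> [|x y]; last exact: tensDl.
by apply: (addrI (tens 0 1)); rewrite addr0 -tensDl addr0.
Qed.
Definition tens1 (x : M) : scalars := tens x 1.
HB.instance Definition _ := GRing.isNmodMorphism.Build M scalars tens1 tens1_nmod.

Lemma scalars_ext (N : lmodType R) (f g : {linear scalars -> N}) :
  (forall x, f (tens x 1) = g (tens x 1)) -> f =1 g.
Proof.
move=> fg; apply: qmod_ext => v.
have -> : qproj v = \sum_(x <- msupp v) v@_x *: tens x 1.
  rewrite {1}[v]monalgE linear_sum; apply: eq_bigr => x _.
  by rewrite -tensZ mulr1.
by rewrite !linear_sum; apply: eq_bigr => x _; rewrite !linearZ /= fg.
Qed.

Section Lift.
Variables (N : lmodType R) (f : {additive M -> N}).

Fact scalars_lift_subproof :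
  {in span scalars_rel, forall v, malg_ext f v = 0}.
Proof.
pose K := [pred v | malg_ext f v == 0].
have KP : submod_closed K.
  split=> [|a u v]; rewrite !inE ?linear0 //.
  by move=> /eqP u0 /eqP v0; rewrite linearP /= u0 v0 scaler0 addr0.
move=> v /(@span_sub _ _ _ (Submodule KP)) vK; apply/eqP/vK => {v vK} _ [x [y ->]].
have mU z : malg_ext f << z >> = f z by rewrite -[RHS]scale1r; exact: malg_extU.
rewrite inE !linearB /=; apply/eqP; transitivity (f (x + y) - f x - f y).
  by congr (_ - _ - _); exact: mU.
by rewrite raddfD addrAC addrK subrr.
Qed.

Definition scalars_lift : scalars -> N := qlift scalars_lift_subproof.
HB.instance Definition _ := GRing.Linear.on scalars_lift.

Lemma scalars_lift_tens x r : scalars_lift (tens x r) = r *: f x.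
Proof. by rewrite /scalars_lift /tens qlift_proj; exact: malg_extU. Qed.
End Lift.
End Object.

Definition scalars_map (M N : zmodType) (f : {additive M -> N}) :
  scalars M -> scalars N := scalars_lift (@tens1 N \o f).
HB.instance Definition _ (M N : zmodType) (f : {additive M -> N}) :=
  GRing.Linear.on (scalars_map f).

Lemma scalars_map_tens (M N : zmodType) (f : {additive M -> N}) x r :
  scalars_map f (tens x r) = tens (f x) r.
Proof. by rewrite /scalars_map scalars_lift_tens /= -tensZ mulr1. Qed.

End Scalars.

Record digraph := Digraph {
  vert : finType;
  edge : finType;
  src : edge -> vert;
  tgt : edge -> vert
}.

(* [i] stands for [g ^ i]; [ordS i] is [i + 1] modulo [n]. *)
Definition dcycle (n : nat) : digraph :=
  @Digraph 'I_n 'I_n (fun i => i) (fun i => ordS i).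

Section Components.
Variable Y : digraph.

Definition adjacent : rel (vert Y) := fun u v =>
  [exists e : edge Y, (src e == u) && (tgt e == v) || (src e == v) && (tgt e == u)].

Definition num_components : nat := n_comp adjacent (vert Y).

Definition is_component (C : {set vert Y}) : Prop :=
  exists v, C = [set w | connect adjacent v w].

Lemma adjacent_sym : symmetric adjacent.
Proof. by move=> u v; apply: eq_existsb => e; rewrite orbC. Qed.

Lemma adjacent_connect_sym : connect_sym adjacent.
Proof. exact: sym_connect_sym adjacent_sym. Qed.

Definition induced (S : {set vert Y}) : digraph :=
  @Digraph {v : vert Y | v \in S} {e : edge Y | (src e \in S) && (tgt e \in S)}
    (fun e => exist _ (src (val e)) (proj1 (andP (valP e))))
    (fun e => exist _ (tgt (val e)) (proj2 (andP (valP e)))).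

End Components.

Section BowenFranks.
Variable Y : digraph.

Definition Div : Type := {ffun vert Y -> int^o}.
HB.instance Definition _ := GRing.Lmodule.on Div.

Definition pt (v : vert Y) : Div := [ffun w => (w == v)%:R].

Definition adj (D : Div) : Div :=
  \sum_v D v *: \sum_(e : edge Y | src e == v) pt (tgt e).

Lemma adjE D w : adj D w = \sum_(e : edge Y | tgt e == w) D (src e).
Proof.
rewrite /adj sum_ffunE.
under eq_bigr => v _ do rewrite ffunE sum_ffunE scaler_sumr big_mkcond.
rewrite exchange_big /= [RHS]big_mkcond; apply: eq_bigr => e _.
rewrite -big_mkcond (big_pred1 (src e)) => [|v]; last by rewrite eq_sym.
rewrite ffunE eq_sym; case: eqP => _; last by rewrite scaler0.
exact: mulr1.
Qed.

Fact adj_linear : linear adj.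
Proof.
move=> a D F; apply/ffunP => w; rewrite ffunE adjE [in RHS]ffunE !adjE.
rewrite scaler_sumr -big_split; apply: eq_bigr => e _.
by rewrite !ffunE.
Qed.
HB.instance Definition _ := GRing.isLinear.Build int Div Div *:%R adj adj_linear.

Definition one_sub_adj (D : Div) : Div := D - adj D.
Fact one_sub_adj_linear : linear one_sub_adj.
Proof.
by move=> a D F; rewrite /one_sub_adj linearP opprD addrACA scalerBr.
Qed.
HB.instance Definition _ :=
  GRing.isLinear.Build int Div Div *:%R one_sub_adj one_sub_adj_linear.

Definition BF : Type := qmod (img one_sub_adj).
HB.instance Definition _ := GRing.Lmodule.on BF.

(* Matrices act on row vectors in MathComp ([eigenspace] included), so the
   image of the [i]-th vertex is the [i]-th row. *)
Definition adj_mx : 'M[rat]_#|vert Y| :=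
  \matrix_(i, j) (adj (pt (enum_val i)) (enum_val j))%:~R.

Definition alg_mult1 : nat := mup 1 (char_poly adj_mx).
Definition geom_mult1 : nat := \rank (eigenspace adj_mx 1).
Definition defect : int := alg_mult1%:Z - geom_mult1%:Z.

End BowenFranks.

(* Morphisms that are bijective from the edges leaving a vertex to the edges
   leaving its image: they are the ones whose pushforward of divisors commutes
   with the adjacency operators ([push_adj]). *)
Record cover (Y Z : digraph) := Cover {
  cvert :> vert Y -> vert Z;
  cedge : edge Y -> edge Z;
  cover_src : forall e, src (cedge e) = cvert (src e);
  cover_tgt : forall e, tgt (cedge e) = cvert (tgt e);
  cover_inj : forall e1 e2, src e1 = src e2 -> cedge e1 = cedge e2 -> e1 = e2;
  cover_surj : forall v e, src e = cvert v -> exists2 e', src e' = v & cedge e' = e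
}.

Section OneCover.
Variables (Y Z : digraph) (c : cover Y Z).

Definition push (D : Div Y) : Div Z := [ffun w => \sum_(v | c v == w) D v].

Fact push_linear : linear push.
Proof.
move=> a D F; apply/ffunP => w; rewrite !ffunE scaler_sumr -big_split.
by apply: eq_bigr => v _; rewrite !ffunE.
Qed.
HB.instance Definition _ := GRing.isLinear.Build int (Div Y) (Div Z) *:%R push push_linear.

Lemma push_pt v : push (pt v) = pt (c v).
Proof.
apply/ffunP => w; rewrite !ffunE big_mkcond (bigD1 v) //= big1 => [|u /negPf uv].
  by rewrite ffunE eqxx addr0 eq_sym; case: eqP.
by rewrite ffunE uv if_same.
Qed.

Lemma push_adj D : push (adj D) = adj (push D).
Proof.
apply/ffunP => w; rewrite ffunE adjE.
under eq_bigr do rewrite adjE.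
under [RHS]eq_bigr do rewrite ffunE.
transitivity (\sum_(e : edge Y | tgt (cedge c e) == w) D (src e)).
  rewrite (exchange_big_dep (fun e => tgt (cedge c e) == w)) /=.
    apply: eq_bigr => e /eqP ew; rewrite (big_pred1 (tgt e)) // => v.
    by rewrite [RHS]eq_sym andb_idl // => /eqP <-; rewrite -cover_tgt ew.
  by move=> v e /eqP vw /eqP ev; rewrite cover_tgt ev vw.
rewrite (partition_big (cedge c) (fun e => tgt e == w)) //=.
apply: eq_bigr => e /eqP ew.
rewrite (partition_big (@src Y) (fun v => c v == src e)) /=; last first.
  by move=> e' /andP[_ /eqP <-]; rewrite cover_src.
apply: eq_bigr => v /eqP vE; have [e0 e0v e0e] := cover_surj (esym vE).
rewrite (big_pred1 e0) ?e0v // => e'; apply/idP/eqP => [|->].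
  by case/andP=> /andP[_ /eqP e'e] /eqP e'v; apply: (cover_inj (c := c)); rewrite ?e0v ?e0e.
by rewrite e0e e0v ew !eqxx.
Qed.

Fact BF_map_subproof :
  {in img (@one_sub_adj Y), forall D, (qproj \o push) D = 0 :> BF Z}.
Proof.
move=> _ /asboolP[D <-] /=; apply/qproj_eq0/asboolP; exists (push D).
by rewrite /one_sub_adj linearB /= push_adj.
Qed.

Definition BF_map : BF Y -> BF Z := qlift BF_map_subproof.
HB.instance Definition _ := GRing.Linear.on BF_map.

Lemma BF_map_proj D : BF_map (qproj D) = qproj (push D).
Proof. exact: qlift_proj. Qed.

End OneCover.

Section CoverComp.
Variables (X Y Z : digraph) (c : cover X Y) (d : cover Y Z).

Fact cover_comp_src e : src (cedge d (cedge c e)) = d (c (src e)).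
Proof. by rewrite !cover_src. Qed.
Fact cover_comp_tgt e : tgt (cedge d (cedge c e)) = d (c (tgt e)).
Proof. by rewrite !cover_tgt. Qed.
Fact cover_comp_inj e1 e2 :
  src e1 = src e2 -> cedge d (cedge c e1) = cedge d (cedge c e2) -> e1 = e2.
Proof.
move=> s12 e12; apply: (cover_inj (c := c)) => //.
by apply: (cover_inj (c := d)); rewrite ?cover_src ?s12.
Qed.
Fact cover_comp_surj v e : src e = d (c v) ->
  exists2 e', src e' = v & cedge d (cedge c e') = e.
Proof.
move=> /cover_surj[e1 /cover_surj[e2 e2v <-] <-].
by exists e2.
Qed.
Definition cover_comp : cover X Z :=
  Cover cover_comp_src cover_comp_tgt cover_comp_inj cover_comp_surj.
End CoverComp.

Lemma push_id (Y : digraph) (c : cover Y Y) : (forall v, c v = v) -> push c =1 id.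
Proof.
move=> cE D; apply/ffunP => v; rewrite ffunE (big_pred1 v) // => u.
by rewrite cE.
Qed.

Lemma push_comp (X Y Z : digraph) (c : cover X Y) (d : cover Y Z) (b : cover X Z) :
  (forall v, b v = d (c v)) -> push b =1 push d \o push c.
Proof.
move=> bE D; apply/ffunP => w; rewrite !ffunE.
under [RHS]eq_bigr do rewrite ffunE.
rewrite (partition_big c (fun v => d v == w)) /=; last by move=> v; rewrite bE.
apply: eq_bigr => v /eqP dv; apply: eq_bigl => u.
by rewrite andb_idl // => /eqP uv; rewrite bE uv dv.
Qed.

Section Scalars.
Variable R : comNzRingType.

(* [BF Y \otimes_Z R] *)
Definition BFR (Y : digraph) : Type := scalars R (BF Y).
HB.instance Definition _ Y := GRing.Lmodule.on (BFR Y).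

Definition BFR_map (Y Z : digraph) (c : cover Y Z) : BFR Y -> BFR Z :=
  scalars_map (BF_map c).
HB.instance Definition _ Y Z (c : cover Y Z) := GRing.Linear.on (BFR_map c).

Lemma BFR_ext (Y : digraph) (N : lmodType R) (f g : {linear BFR Y -> N}) :
  (forall D : Div Y, f (tens (qproj D) 1) = g (tens (qproj D) 1)) -> f =1 g.
Proof.
by move=> fg; apply: scalars_ext => x; rewrite -[x]qreprK; exact: fg.
Qed.

Lemma BFR_map_tens (Y Z : digraph) (c : cover Y Z) D r :
  BFR_map c (tens (qproj D) r) = tens (qproj (push c D)) r.
Proof. by rewrite /BFR_map scalars_map_tens; congr tens; exact: BF_map_proj. Qed.

Lemma BFR_map_id (Y : digraph) (c : cover Y Y) :
  (forall v, c v = v) -> BFR_map c =1 id.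
Proof.
move=> cE; apply: (@BFR_ext _ _ (BFR_map c) idfun) => D.
by apply: etrans (BFR_map_tens c D 1) _; rewrite push_id.
Qed.

Lemma BFR_map_comp (X Y Z : digraph) (c : cover X Y) (d : cover Y Z) (b : cover X Z) :
  (forall v, b v = d (c v)) -> BFR_map b =1 BFR_map d \o BFR_map c.
Proof.
move=> bE; apply: (@BFR_ext _ _ (BFR_map b) (BFR_map d \o BFR_map c)) => D.
apply: etrans (BFR_map_tens b D 1) _; rewrite (push_comp bE) /=.
by apply: esym; rewrite (BFR_map_tens c D 1); exact: BFR_map_tens.
Qed.

End Scalars.
Arguments BFR_map R {Y Z} c _.

Section InducedCover.
Variables (Y Z : digraph) (c : cover Y Z) (S : {set vert Y}) (T : {set vert Z}).
Hypothesis ST : forall v, (v \in S) = (c v \in T).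

Fact induced_vert_subproof (v : vert (induced S)) : c (val v) \in T.
Proof. by rewrite -ST (valP v). Qed.
Fact induced_edge_subproof (e : edge (induced S)) :
  (src (cedge c (val e)) \in T) && (tgt (cedge c (val e)) \in T).
Proof. by rewrite cover_src cover_tgt -!ST (valP e). Qed.

Definition induced_vert (v : vert (induced S)) : vert (induced T) := Sub (c (val v)) (induced_vert_subproof v).
Definition induced_edge (e : edge (induced S)) : edge (induced T) :=
  Sub (cedge c (val e)) (induced_edge_subproof e).

Fact induced_cover_src e : src (induced_edge e) = induced_vert (src e).
Proof. by apply: val_inj; rewrite /= cover_src. Qed.
Fact induced_cover_tgt e : tgt (induced_edge e) = induced_vert (tgt e).
Proof. by apply: val_inj; rewrite /= cover_tgt. Qed.
Fact induced_cover_inj (e1 e2 : edge (induced S)) :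
  src e1 = src e2 -> induced_edge e1 = induced_edge e2 -> e1 = e2.
Proof.
move=> /(congr1 val) /= se /(congr1 val) /= ce.
by apply: val_inj; apply: cover_inj se ce.
Qed.
Fact induced_cover_surj (v : vert (induced S)) (e : edge (induced T)) :
  src e = induced_vert v -> exists2 e', src e' = v & induced_edge e' = e.
Proof.
move=> /(congr1 val) /= /cover_surj[e' e'v e'e].
have e'S : (src e' \in S) && (tgt e' \in S).
  by rewrite e'v (valP v) ST -cover_tgt e'e; case/andP: (valP e).
by exists (Sub e' e'S); apply: val_inj.
Qed.

Definition induced_cover : cover (induced S) (induced T) :=
  Cover induced_cover_src induced_cover_tgt induced_cover_inj induced_cover_surj.

End InducedCover.

Section CyclicQuotients.
Variable p : nat.

(* [Gamma / Gamma^(p^m)] in additive notation, that is [Z / p^m Z] for [p > 0];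
   the [.-1.+1] makes it a group by type inference also for [m = 0], where
   ['Z_(p ^ m)] would be [Z / 2Z]. *)
Definition cyc (m : nat) : finZmodType := 'I_(p ^ m).-1.+1.

Definition theta m : cyc m := inZp 1.

Definition cyc_red m' m (g : cyc m') : cyc m := inZp g.

(* the isomorphism from [Gamma' / Gamma'^(p^k)] to
   [Gamma^(p^m0) / Gamma^(p^(m0 + k))], where [Gamma' = Gamma^(p^m0)] *)
Definition cyc_lift m0 k (h : cyc k) : cyc (m0 + k) := inZp (p ^ m0 * h).

Fact cyc0_order m : ((0 ^ m).-1.+1 = 1)%N.
Proof. by case: m => [|m] //; rewrite exp0n. Qed.

Lemma cyc_dvd m m' : (m <= m')%N -> ((p ^ m).-1.+1 %| (p ^ m').-1.+1)%N.
Proof.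
case: p => [|q] mm'; last by rewrite !prednK ?expn_gt0 // dvdn_exp2l.
by rewrite cyc0_order dvd1n.
Qed.

Lemma cyc_redK m1 m2 m3 (g : cyc m1) : (m3 <= m2)%N ->
  cyc_red m3 (cyc_red m2 g) = cyc_red m3 g.
Proof. by move=> /cyc_dvd d; apply: val_inj; rewrite /= modn_dvdm. Qed.

Lemma cyc_red_id m (g : cyc m) : cyc_red m g = g.
Proof. by apply: val_inj; rewrite /= modn_small. Qed.

Lemma cyc_redD m1 m2 : (m2 <= m1)%N ->
  {morph @cyc_red m1 m2 : g h / g + h}.
Proof. by move=> /cyc_dvd d g h; apply: val_inj; rewrite /= modn_dvdm // modnDm. Qed.

Lemma cyc_red_theta m1 m2 : (m2 <= m1)%N -> cyc_red m2 (theta m1) = theta m2.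
Proof. by move=> /cyc_dvd d; apply: val_inj; rewrite /= modn_dvdm. Qed.

Lemma cyc_red_lift m0 k h : cyc_red m0 (@cyc_lift m0 k h) = 0.
Proof.
apply: val_inj; rewrite /= modn_dvdm ?cyc_dvd ?leq_addr //.
move: (nat_of_ord h) => a.
by case: p => [|q]; [rewrite cyc0_order modn1 | rewrite prednK ?expn_gt0 ?modnMr].
Qed.

Lemma cyc_lift0 m0 k : @cyc_lift m0 k 0 = 0.
Proof. by apply: val_inj; rewrite /= muln0 mod0n. Qed.

Lemma cyc_mul_mod m0 k a :
  (p ^ m0 * (a %% (p ^ k).-1.+1) = p ^ m0 * a %[mod (p ^ (m0 + k)).-1.+1])%N.
Proof.
case: p => [|q].
  by rewrite !cyc0_order !modn1.
by rewrite !prednK ?expn_gt0 // muln_modr -expnD modn_mod.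
Qed.

Lemma cyc_liftD m0 k : {morph @cyc_lift m0 k : g h / g + h}.
Proof.
by move=> g h; apply: val_inj; rewrite /= cyc_mul_mod mulnDr modnDm.
Qed.

Lemma cyc_red_lift_succ m0 k (h : cyc k.+1) :
  cyc_red (m0 + k) (cyc_lift m0 h) = cyc_lift m0 (cyc_red k h).
Proof.
apply: val_inj; rewrite /= modn_dvdm ?cyc_dvd ?leq_add2l //.
by rewrite cyc_mul_mod.
Qed.

Fact cyc_red_nmod k : nmod_morphism (@cyc_red k.+1 k).
Proof.
split; last exact: cyc_redD.
by apply: val_inj; rewrite /= mod0n.
Qed.
HB.instance Definition _ k := GRing.isNmodMorphism.Build _ _ (@cyc_red k.+1 k) (cyc_red_nmod k).

End CyclicQuotients.

Section Tower.
Variables (X : digraph) (p : nat).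

Definition layer (m : nat) : digraph :=
  @Digraph (vert X * cyc p m)%type (edge X * cyc p m)%type
    (fun eg => (src eg.1, eg.2)) (fun eg => (tgt eg.1, eg.2 + theta p m)).

Section Projection.
Variables (m' m : nat) (mm' : (m <= m')%N).

Definition proj_vert (v : vert (layer m')) : vert (layer m) := (v.1, cyc_red m v.2).
Definition proj_edge (e : edge (layer m')) : edge (layer m) := (e.1, cyc_red m e.2).

Fact proj_src e : src (proj_edge e) = proj_vert (src e).
Proof. by []. Qed.
Fact proj_tgt e : tgt (proj_edge e) = proj_vert (tgt e).
Proof. by rewrite /= /proj_vert /= cyc_redD // cyc_red_theta. Qed.
Fact proj_inj (e1 e2 : edge (layer m')) :
  src e1 = src e2 -> proj_edge e1 = proj_edge e2 -> e1 = e2.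
Proof. by case: e1 e2 => [e1 g1] [e2 g2] /= [_ ->] [->]. Qed.
Fact proj_surj (v : vert (layer m')) (e : edge (layer m)) :
  src e = proj_vert v -> exists2 e', src e' = v & proj_edge e' = e.
Proof.
case: v e => [v g] [e h] [ev hg].
by exists (e, g); [rewrite /= ev | rewrite /proj_edge /= hg].
Qed.

Definition proj : cover (layer m') (layer m) :=
  Cover proj_src proj_tgt proj_inj proj_surj.
End Projection.

Section Deck.
Variables (m : nat) (h : cyc p m).

Definition deck_vert (v : vert (layer m)) : vert (layer m) := (v.1, v.2 + h).
Definition deck_edge (e : edge (layer m)) : edge (layer m) := (e.1, e.2 + h).

Fact deck_src e : src (deck_edge e) = deck_vert (src e).
Proof. by []. Qed.
Fact deck_tgt e : tgt (deck_edge e) = deck_vert (tgt e).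
Proof. by rewrite /= /deck_vert /= addrAC. Qed.
Fact deck_inj (e1 e2 : edge (layer m)) :
  src e1 = src e2 -> deck_edge e1 = deck_edge e2 -> e1 = e2.
Proof. by case: e1 e2 => [e1 g1] [e2 g2] /= [_ ->] [->]. Qed.
Fact deck_surj (v : vert (layer m)) (e : edge (layer m)) :
  src e = deck_vert v -> exists2 e', src e' = v & deck_edge e' = e.
Proof.
case: v e => [v g] [e k] [ev kg].
by exists (e, g); [rewrite /= ev | rewrite /deck_edge /= kg].
Qed.

Definition deck : cover (layer m) (layer m) :=
  Cover deck_src deck_tgt deck_inj deck_surj.
End Deck.

Definition stable_from (m0 : nat) : Prop :=
  forall m, (m0 <= m)%N -> num_components (layer m) = num_components (layer m0).

Definition is_stabilization_index (m0 : nat) : Prop :=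
  stable_from m0 /\ forall m, stable_from m -> (m0 <= m)%N.

Lemma stabilization_index_unique m0 m1 :
  is_stabilization_index m0 -> is_stabilization_index m1 -> m0 = m1.
Proof. by case=> s0 h0 [s1 h1]; apply/eqP; rewrite eqn_leq h0 ?h1. Qed.

Section Component.
Variables (m0 : nat) (C : {set vert (layer m0)}).

(* When [m0] is the stabilization index and [C] a component, this is the unique
   component of the layer [m0 + k] above [C]: see [above_component] and
   [above_component_unique]. *)
Definition above_set (k : nat) : {set vert (layer (m0 + k))} :=
  [set v | proj_vert m0 v \in C].
Definition above (k : nat) : digraph := induced (above_set k).

Fact above_proj_subproof k (v : vert (layer (m0 + k.+1))) :
  (v \in above_set k.+1) = (proj_vert (m0 + k) v \in above_set k).
Proof. by rewrite !inE /proj_vert /= cyc_redK // leq_addr. Qed.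
Fact leq_add_succ k : (m0 + k <= m0 + k.+1)%N.
Proof. by rewrite leq_add2l. Qed.

Definition above_proj k : cover (above k.+1) (above k) :=
  induced_cover (c := proj (leq_add_succ k)) (@above_proj_subproof k).

Fact above_deck_subproof k (h : cyc p k) (v : vert (layer (m0 + k))) :
  (v \in above_set k) = (deck_vert (cyc_lift m0 h) v \in above_set k).
Proof. by rewrite !inE /proj_vert /= cyc_redD ?leq_addr // cyc_red_lift addr0. Qed.

Definition above_deck k (h : cyc p k) : cover (above k) (above k) :=
  induced_cover (c := deck (cyc_lift m0 h)) (above_deck_subproof h).

Fact above_deck0 k x : BFR_map (padic p) (@above_deck k 0) x = x.
Proof.
apply: BFR_map_id => v; apply: val_inj.
by rewrite /= /deck_vert cyc_lift0 addr0 -surjective_pairing.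
Qed.
Fact above_deckD k (g h : cyc p k) x :
  BFR_map (padic p) (above_deck (g + h)) x =
  BFR_map (padic p) (above_deck g) (BFR_map (padic p) (above_deck h) x).
Proof.
apply: BFR_map_comp => v; apply: val_inj.
by rewrite /= /deck_vert /= cyc_liftD addrAC addrA.
Qed.

Definition deck_action k : linear_action (cyc p k) (BFR (padic p) (above k)) :=
  @LinearAction _ _ _ (fun h => BFR_map (padic p) (above_deck h))
    (@above_deck0 k) (@above_deckD k).

End Component.
End Tower.

Section IwasawaAlgebra.
Variable p : nat.

Definition level_ring (k : nat) : comNzRingType := grpring (padic p) (cyc p k).
Definition level_red (k : nat) : {rmorphism level_ring k.+1 -> level_ring k} :=
  gr_map (@cyc_red p k.+1 k).

(* [Lambda = Z_p[[Gamma']]], the completed group algebra; it is isomorphic to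
   [Z_p[[T]]] through [1 + T |-> gamma]. *)
Definition iwalg : Type := rlim level_red.
HB.instance Definition _ := GRing.ComNzRing.on iwalg.

Fact iwalg_gammaP k :
  level_red k (gr_base (padic p) (theta p k.+1)) = gr_base (padic p) (theta p k).
Proof.
apply/ffunP => h; rewrite !ffunE big_mkcond (bigD1 (theta p k.+1)) //=.
rewrite big1 => [|g /negPf gt]; last by rewrite ffunE gt if_same.
by rewrite ffunE eqxx addr0 cyc_red_theta // eq_sym; case: eqP.
Qed.
Definition iwalg_gamma : iwalg := @RLim _ level_red _ iwalg_gammaP.

Definition iwalg_T : iwalg := iwalg_gamma - 1.

Fact iwalg_constP a k :
  level_red k (gr_const (cyc p k.+1) a) = gr_const (cyc p k) a.
Proof.
apply/ffunP => h; rewrite !ffunE big_mkcond (bigD1 0) //= big1 => [|g /negPf g0].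
  by rewrite ffunE eqxx addr0 raddf0 eq_sym.
by rewrite ffunE g0 if_same.
Qed.
Definition iwalg_const (a : padic p) : iwalg := @RLim _ level_red _ (iwalg_constP a).

Fact iwalg_const_zmod : zmod_morphism iwalg_const.
Proof. by move=> a b; apply: rlim_ext => k; exact: (raddfB (@gr_const _ (cyc p k))). Qed.
Fact iwalg_const_monoid : monoid_morphism iwalg_const.
Proof.
split=> [|a b]; apply: rlim_ext => k; first by [].
exact: (rmorphM (@gr_const _ (cyc p k))).
Qed.
HB.instance Definition _ :=
  GRing.isZmodMorphism.Build (padic p) iwalg iwalg_const iwalg_const_zmod.
HB.instance Definition _ :=
  GRing.isMonoidMorphism.Build (padic p) iwalg iwalg_const iwalg_const_monoid.

Definition iwalg_eval (f : {poly padic p}) : iwalg := (map_poly iwalg_const f).[iwalg_T].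

Definition distinguished (f : {poly padic p}) : Prop :=
  f \is monic /\ forall i, (i < (size f).-1)%N -> exists a : padic p, f`_i = p%:R * a.

End IwasawaAlgebra.

Section Invariants.

Section PseudoIsomorphism.
Variables (R : comNzRingType).

Definition cyclic_mod (a : R) : lmodType R := qmod (span (V := R^o) (fun b => b = a)).

Definition finitely_generated (M : lmodType R) : Prop :=
  exists s : seq M, forall x, exists c : 'I_(size s) -> R, x = \sum_i c i *: s`_i.

(* The rings to which this is applied are integral domains. *)
Definition torsion_mod (M : lmodType R) : Prop :=
  forall x : M, exists2 a : R, a != 0 & a *: x = 0.

Definition pseudo_isomorphic (M N : lmodType R) : Prop :=
  exists phi : {linear M -> N},
    finite_set [set x | phi x = 0] /\ finite_set [set: qmod (img phi)].

End PseudoIsomorphism.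

Variable p : nat.

Definition elementary_mod (ms : seq nat) (fs : seq {poly padic p}) : lmodType (iwalg p) :=
  let rels := [seq (p ^ m)%:R | m <- ms] ++ [seq iwalg_eval f | f <- fs] in
  dsum (fun i : 'I_(size rels) => cyclic_mod rels`_i).

(* By the uniqueness part of the structure theorem, a module has at most one
   pair of invariants; the invariants are therefore given as a relation. *)
Definition iwasawa_invariants (M : lmodType (iwalg p)) (mu lambda : nat) : Prop :=
  [/\ finitely_generated M, torsion_mod M &
   exists ms fs,
     [/\ (forall m, m \in ms -> (0 < m)%N),
         (forall f, f \in fs -> distinguished f),
         pseudo_isomorphic M (elementary_mod ms fs),
         mu = (\sum_(m <- ms) m)%N & lambda = (\sum_(f <- fs) (size f).-1)%N]].

End Invariants.

Section BowenFranksModule.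
Variables (X : digraph) (p m0 : nat) (C : {set vert (layer X p m0)}).

Definition level_mod (k : nat) : lmodType (level_ring p k) :=
  grmod (deck_action C k).

(* The transition maps are those of the Bowen-Franks groups; by [level_mapZ]
   they are semilinear for the action of the group rings. *)
Definition level_map (k : nat) : {additive level_mod k.+1 -> level_mod k} :=
  BFR_map (padic p) (above_proj C k).

Fact level_map_act k (g : cyc p k.+1) (x : level_mod k.+1) :
  level_map k (deck_action C k.+1 g x) = deck_action C k (cyc_red k g) (level_map k x).
Proof.
pose b := cover_comp (above_deck C g) (above_proj C k).
transitivity (BFR_map (padic p) b x); first exact/esym/BFR_map_comp.
apply: (@BFR_map_comp _ _ _ _ (above_proj C k) (above_deck C (cyc_red k g)) b) => v.
apply: val_inj; rewrite /= /proj_vert /deck_vert /=.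
by rewrite cyc_redD ?leq_add_succ // cyc_red_lift_succ.
Qed.

Fact level_mapZ k (a : level_ring p k.+1) (x : level_mod k.+1) :
  level_map k (a *: x) = level_red p k a *: level_map k x.
Proof.
transitivity (\sum_g a g *: deck_action C k (cyc_red k g) (level_map k x)).
  transitivity (\sum_g level_map k (a g *: deck_action C k.+1 g x)).
    exact: raddf_sum.
  apply: eq_bigr => g _; rewrite -level_map_act.
  exact: (linearZ_LR (BFR_map (padic p) (above_proj C k))).
rewrite (partition_big (@cyc_red p k.+1 k) xpredT) //=.
apply: eq_bigr => h _; rewrite ffunE scaler_suml.
by apply: eq_bigr => g /eqP <-.
Qed.

Definition BF_infty : lmodType (iwalg p) := mlim level_mapZ.

End BowenFranksModule.

Section AboveComponent.
Variables (X : digraph) (p m0 : nat).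

Lemma connect_proj m m' (mm' : (m <= m')%N) (u v : vert (layer X p m')) :
  connect (@adjacent (layer X p m')) u v ->
  connect (@adjacent (layer X p m)) (proj_vert m u) (proj_vert m v).
Proof.
case/connectP=> s; elim: s u => [|w s IHs] u /=; first by move=> _ ->.
case/andP=> /existsP[e uw] sP vE; apply: connect_trans (IHs w sP vE).
apply/connect1/existsP; exists (proj_edge m e).
rewrite (proj_tgt mm') (proj_src m e).
by case/orP: uw => /andP[/eqP <- /eqP <-]; rewrite !eqxx ?orbT.
Qed.

Lemma proj_vert_surj m m' (mm' : (m <= m')%N) (w : vert (layer X p m)) :
  exists v : vert (layer X p m'), proj_vert m v = w.
Proof.
exists (w.1, inZp w.2); case: w => w g; rewrite /proj_vert /=; congr pair.
apply: val_inj; rewrite /= modn_dvdm ?cyc_dvd //.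
by rewrite modn_small.
Qed.

Lemma connect_proj_inv m m' (mm' : (m <= m')%N) :
  num_components (layer X p m') = num_components (layer X p m) ->
  forall u v : vert (layer X p m'),
  connect (@adjacent (layer X p m)) (proj_vert m u) (proj_vert m v) ->
  connect (@adjacent (layer X p m')) u v.
Proof.
move=> nE u v uv; set e' := @adjacent (layer X p m'); set e := @adjacent (layer X p m).
have s' : connect_sym e' := @adjacent_connect_sym _.
have s : connect_sym e := @adjacent_connect_sym _.
pose R' := [set x | roots e' x]; pose R := [set x | roots e x].
pose f (x : vert (layer X p m')) := fingraph.root e (proj_vert m x).
have fR : f @: R' = R.
  apply/setP => y; apply/imsetP/idP => [[x _ ->]|].
    by rewrite inE roots_root.
  rewrite inE => /eqP yR; have [x xy] := proj_vert_surj mm' y.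
  exists (fingraph.root e' x); first by rewrite inE roots_root.
  rewrite /f -yR; apply/eqP; rewrite root_connect // -xy.
  by apply: connect_proj => //; apply: connect_root.
have cR : #|f @: R'| = #|R'|.
  have cE (T : finType) (r : rel T) : #|[set x | roots r x]| = n_comp r T.
    by rewrite cardsE; apply: eq_card => x; rewrite !inE andbT.
  by rewrite fR !cE; apply: esym.
have fI : {in R' &, injective f} by apply/imset_injP; rewrite cR.
have fr x : f (fingraph.root e' x) = f x.
  by apply/eqP; rewrite root_connect // s; apply: connect_proj => //; apply: connect_root.
rewrite -root_connect //; apply/eqP; apply: fI; rewrite ?inE ?roots_root // !fr.
by apply/eqP; rewrite root_connect.
Qed.

(* If [m0] is past the stabilization, the part of a layer above a component is
   a component, and it is the only one above it. *)
Lemma above_component (C : {set vert (layer X p m0)}) k :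
  stable_from X p m0 -> is_component C -> is_component (above_set C k).
Proof.
move=> st [w ->]; have le := leq_addr k m0.
have [v vw] := proj_vert_surj le w; exists v; apply/setP => u; rewrite !inE -vw.
apply/idP/idP; first exact: connect_proj_inv (st _ le) _ _.
exact: connect_proj.
Qed.

Lemma above_component_unique (C : {set vert (layer X p m0)}) k D :
  stable_from X p m0 -> is_component C -> is_component D ->
  (exists2 v, v \in D & proj_vert m0 v \in C) -> D = above_set C k.
Proof.
move=> st /(above_component k st)[v aE] [w DE] [u uD uC].
have : u \in above_set C k by rewrite inE.
move: uD; rewrite aE DE !inE => wu vu; apply/setP => x; rewrite !inE.
have cs := @adjacent_connect_sym (layer X p (m0 + k)).
by rewrite -(same_connect cs (connect_trans wu (etrans (cs _ _) vu))).
Qed.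

End AboveComponent.

(* Main.v *)
From HB Require Import structures.
Require Import Defs.
From mathcomp Require Import all_boot all_order all_algebra all_fingroup.
From mathcomp Require Import boolp classical_sets cardinality.

(** Every digraph in sight is a disjoint union of directed cycles: its edges are
   the graph [v -> s v] of a permutation [s] of its vertices ([cycle_union]).
   This holds for [dcycle n], passes to the layers of the constant tower
   ([layer_cycle_union]) and to their components ([induced_component]).

   Defect: the adjacency matrix is a permutation matrix, so it has finite order,
   and in characteristic zero such a matrix is semisimple. Hence the algebraic
   and geometric multiplicities of 1 agree ([mup1_char_poly_perm_mx],
   [defect_cycle_union]).

   Bowen-Franks group: in [BF Y] each vertex is equal to its successor, so on a
   single cycle the degree of divisors is an isomorphism from [BF Y] to the
   integers, and likewise after extension of scalars ([BFRdegK]). On any union of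
   cycles with a vertex the degree is still onto the integers, which makes
   [BF Y] infinite.

   Stabilization: the permutation of the [m]-th layer of [dcycle n] acts on
   pairs (a residue modulo [n], a residue modulo [p ^ m]) by adding 1 to both, so
   all its orbits have [lcmn n (p ^ m)] elements and there are [gcdn n (p ^ m)]
   of them. This number is constant exactly from [logn p n] on.

   Iwasawa module: the degree is preserved by the pushforward along any cover,
   hence by the transition maps and by the deck transformations. Therefore
   [BF_infty C] is a copy of the [p]-adic integers on which the group acts
   trivially, that is, on which an element of the Iwasawa algebra acts through its
   augmentation. It is thus the quotient of the Iwasawa algebra by the augmentation
   ideal, and that ideal is generated by [T] ([iwalg_aug_eq0]). So the module is
   isomorphic to the elementary module with the single distinguished polynomial
   ['X], whence mu = 0 and lambda = 1.

   The one analytic point is [iwalg_aug_eq0]. At each finite level an element of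
   augmentation 0 is [theta - 1] times its discrete primitive, which is determined
   only up to constant functions. The transition maps multiply constant functions
   by [p], so making the primitives compatible amounts to solving
   [d k = c k + p * d k.+1] for all [k], which the convergent series
   [d k = \sum_i p ^ i * c (k + i)] does. *)

Set Implicit Arguments.
Unset Strict Implicit.
Unset Printing Implicit Defensive.

Import GRing.Theory.
Local Open Scope classical_set_scope.
Local Open Scope ring_scope.

(** * Multiplicity of an eigenvalue of a semisimple matrix *)

(** The two sizes are kept distinct because the change of basis is applied to a
   block decomposition, of size a sum of two ranks. *)
Lemma char_poly_conj (F : fieldType) (m n : nat) (P : 'M[F]_(m, n))
    (Q : 'M[F]_(n, m)) (A : 'M[F]_n) :
  m = n -> P *m Q = 1%:M -> char_poly (P *m A *m Q) = char_poly A.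
Proof.
move=> mn; case: n / mn P Q A => P Q A PQ1.
have PpQp : map_mx (@polyC F) P *m map_mx (@polyC F) Q = 1%:M.
  by rewrite -map_mxM PQ1 map_mx1.
rewrite /char_poly /char_poly_mx.
have -> : 'X%:M - map_mx (@polyC F) (P *m A *m Q) =
  map_mx (@polyC F) P *m ('X%:M - map_mx (@polyC F) A) *m map_mx (@polyC F) Q.
  rewrite !map_mxM mulmxBr mulmxBl; congr (_ - _).
  by rewrite scalar_mxC -mulmxA PpQp mulmx1.
by rewrite !det_mulmx mulrAC -det_mulmx PpQp det1 mul1r.
Qed.

(** With [B = A - a], the hypothesis says that the kernel and the image of [B] are
   disjoint, so that the space is their direct sum. In an adapted basis [A] is
   block diagonal, [a] on the kernel and some [C] on the image, and a nonzero
   vector killed by [C - a] would be a vector of the image lying in the kernel. *)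
Lemma mup_char_poly_semisimple (F : fieldType) (n : nat) (A : 'M[F]_n) (a : F) :
  (forall u : 'rV_n, u *m (A - a%:M) *m (A - a%:M) = 0 -> u *m (A - a%:M) = 0) ->
  mup a (char_poly A) = \rank (eigenspace A a).
Proof.
set B := A - a%:M => ss.
have capKI : (kermx B :&: B = 0)%MS.
  apply/eqP/rowV0P => v; rewrite sub_capmx => /andP[/sub_kermxP vB /submxP[w vE]].
  by rewrite vE; apply: ss; rewrite -vE.
pose K := row_base (kermx B); pose I := row_base B.
have KB : K *m B = 0 by apply/sub_kermxP; rewrite eq_row_base.
have KA : K *m A = a%:M *m K.
  by rewrite -scalar_mxC -[A](subrK a%:M) mulmxDr KB add0r.
have IAs : (I *m A <= I)%MS.
  have IB : (I <= B)%MS by rewrite eq_row_base.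
  rewrite eq_row_base (submx_trans (submxMr A IB)) //.
  have -> : B *m A = A *m B by rewrite /B mulmxBl mulmxBr scalar_mxC.
  exact: submxMl.
pose C := I *m A *m pinvmx I.
have IA : I *m A = C *m I by rewrite mulmxKpV.
pose P := col_mx K I.
have rn : (\rank (kermx B) + \rank B = n)%N.
  by rewrite mxrank_ker subnK // rank_leq_row.
have Pfree : row_free P.
  rewrite /row_free -addsmxE mxrank_disjoint_sum ?eq_row_base //.
  apply/eqP; rewrite -submx0 -capKI.
  by apply: capmxS; rewrite eq_row_base.
have PQ := mulmxVp Pfree.
have PA : P *m A = block_mx a%:M 0 0 C *m P.
  by rewrite mul_col_mx mul_block_col KA IA !mul0mx addr0 add0r.
have -> : char_poly A = ('X - a%:P) ^+ \rank (kermx B) * char_poly C.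
  rewrite -(char_poly_conj A rn PQ) PA -mulmxA PQ mulmx1.
  rewrite /char_poly char_block_diag_mx det_ublock; congr (_ * _).
  by rewrite /char_poly_mx map_scalar_mx -raddfB det_scalar.
rewrite mupMl ?mup_XsubCX ?eqxx // -eigenvalue_root_char.
apply/negP => /eigenvalueP[v vC /negP v0]; apply: v0; apply/eqP.
apply: (row_free_inj (row_base_free B)); rewrite mul0mx -/I.
have vIB : v *m I *m B = 0.
  by rewrite /B mulmxBr -mulmxA IA mulmxA vC -scalemxAl scalar_mxC mul_scalar_mx subrr.
have /submxP[w vIE] : (v *m I <= B)%MS.
  by rewrite (submx_trans (submxMl _ _)) // eq_row_base.
by rewrite vIE; apply: ss; rewrite -vIE.
Qed.

(** If [u A = u + w] with [w] fixed by [A], then [u A ^ k = u + k w]; taking for [k]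
   the order of the permutation gives [k w = 0], hence [w = 0]. *)
Lemma mup1_char_poly_perm_mx (F : fieldType) (n : nat) (s : 'S_n) :
  [pchar F] =i pred0 ->
  mup 1 (char_poly (perm_mx s : 'M[F]_n)) = \rank (eigenspace (perm_mx s : 'M[F]_n) 1).
Proof.
move=> ch0; apply: mup_char_poly_semisimple => u.
set A := perm_mx s; set w := u *m _ => wA0.
have wA : w *m A = w by apply/eqP; rewrite -subr_eq0 -[X in _ - X]mulmx1 -mulmxBr wA0.
have uA : u *m A = u + w by rewrite /w mulmxBr mulmx1 addrC subrK.
have uAk k : u *m perm_mx (s ^+ k)%g = u + w *+ k.
  elim: k => [|k IHk]; first by rewrite expg0 perm_mx1 mulmx1 addr0.
  rewrite expgSr perm_mxM mulmxA IHk mulmxDl uA -scaler_nat -scalemxAl wA.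
  by rewrite scaler_nat mulrS addrA.
have := uAk #[s]%g; rewrite expg_order perm_mx1 mulmx1 -{1}[u]addr0.
move/addrI/esym/eqP; rewrite -scaler_nat scaler_eq0.
case/orP => [|/eqP //]; rewrite ((pcharf0P _).1 ch0) => /eqP n0.
by have := order_gt0 s; rewrite n0.
Qed.

(** * Disjoint unions of directed cycles *)

Definition cycle_union (Y : digraph) (s : {perm vert Y}) : Prop :=
  bijective (@src Y) /\ forall e, tgt e = s (src e).

Lemma adj_pt_cycle_union Y s (u w : vert Y) :
  cycle_union s -> adj (pt u) w = (s u == w)%:R.
Proof.
case=> -[v2e eK vK] ts; rewrite adjE.
rewrite big_mkcond (bigD1 (v2e u)) //= ts !ffunE !vK eqxx.
rewrite big1 ?addr0 => [|e eu]; first by case: eqP.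
rewrite ffunE; case: eqP => // _; case: eqP => // eu'.
by case/eqP: eu; rewrite -eu' eK.
Qed.

Lemma defect_cycle_union Y (s : {perm vert Y}) : cycle_union s -> defect Y = 0.
Proof.
move=> cY; pose t (i : 'I_#|vert Y|) := enum_rank (s (enum_val i)).
have tI : injective t.
  by move=> i j /enum_rank_inj/perm_inj/enum_val_inj.
rewrite /defect /alg_mult1 /geom_mult1.
have -> : adj_mx Y = perm_mx (perm tI).
  apply/matrixP => i j; rewrite !mxE (adj_pt_cycle_union _ _ cY) permE.
  by rewrite -[in RHS](inj_eq enum_val_inj) /t enum_rankK; case: eqP.
by rewrite mup1_char_poly_perm_mx ?subrr //; apply: Num.Theory.pchar_num.
Qed.

Definition dcycle_next n : {perm vert (dcycle n)} := perm (@ordS_inj n).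

Lemma dcycle_cycle_union n : cycle_union (dcycle_next n).
Proof. by split=> [|e]; [exists id | rewrite permE]. Qed.

Section Layer.
Variables (X : digraph) (p m : nat) (s : {perm vert X}).

Definition layer_next (v : vert (layer X p m)) : vert (layer X p m) :=
  (s v.1, v.2 + theta p m).

Lemma layer_next_inj : injective layer_next.
Proof.
move=> [u g] [v h] [/perm_inj -> gh]; congr pair.
by apply: (addIr (theta p m)); apply: val_inj.
Qed.

Definition layer_perm := perm layer_next_inj.

Lemma layer_cycle_union : cycle_union s -> cycle_union layer_perm.
Proof.
case=> -[v2e eK vK] ts; split=> [|[e g]]; last by rewrite permE /layer_next /= ts.
by exists (fun v => (v2e v.1, v.2)) => [[e g]|[v g]]; rewrite /= ?eK ?vK.
Qed.
End Layer.

(** * Components of the layers *)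

Lemma connect_cycle_union Y (s : {perm vert Y}) :
  cycle_union s -> connect (@adjacent Y) =2 fconnect s.
Proof.
case=> -[v2e eK vK] ts u v; apply/idP/idP; last first.
  apply: connect_sub => {}u w /eqP <-; apply/connect1/existsP.
  by exists (v2e u); rewrite ts vK !eqxx.
apply: connect_sub => {}u w /existsP[e]; rewrite ts.
case/orP=> /andP[/eqP <- /eqP <-]; first exact: fconnect1.
by rewrite (fconnect_sym perm_inj) fconnect1.
Qed.

Lemma num_components_cycle_union Y (s : {perm vert Y}) :
  cycle_union s -> num_components Y = fcard s (vert Y).
Proof. by move=> cY; apply: eq_n_comp; apply: connect_cycle_union. Qed.

Lemma order_of_periods (T : finType) (f : T -> T) (x : T) (L : nat) :
  injective f -> (0 < L)%N ->
  (forall k, iter k f x = x <-> (L %| k)%N) -> fingraph.order f x = L.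
Proof.
move=> fI L0 fL; apply/eqP; rewrite eqn_leq [X in _ && X]dvdn_leq ?fingraph.order_gt0 //.
  rewrite andbT leqNgt; apply/negP => /findex_iter; rewrite (fL L).2 // findex0.
  by move=> L1; rewrite -L1 in L0.
by apply/fL; apply: iter_order.
Qed.

Lemma iter_layer_dcycle n p m k (v : vert (layer (dcycle n) p m)) :
  let w := iter k (layer_perm p m (dcycle_next n)) v in
  val w.1 = ((val v.1 + k) %% n)%N /\ val w.2 = ((val v.2 + k) %% (p ^ m).-1.+1)%N.
Proof.
elim: k => [|k] /=; first by rewrite !addn0 !modn_small ?ltn_ord.
case: (iter k _ _) => i g /= [iE gE]; rewrite !permE /= permE /= gE iE.
by rewrite -addn1 modnDml modnDm -!addnA !addn1.
Qed.

(** All orbits have [lcmn n (p ^ m)] elements, among [n * p ^ m] vertices. *)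
Lemma num_components_layer_dcycle n p m : (0 < n)%N -> (0 < p)%N ->
  num_components (layer (dcycle n) p m) = gcdn n (p ^ m).
Proof.
move=> n0 p0; have cY := layer_cycle_union p m (dcycle_cycle_union n).
set s := layer_perm _ _ _ in cY.
have pm0 : (0 < p ^ m)%N by rewrite expn_gt0 p0.
have lcm0 : (0 < lcmn n (p ^ m))%N by rewrite lcmn_gt0 n0.
have sO v : fingraph.order s v = lcmn n (p ^ m).
  apply: order_of_periods => [||k]; rewrite ?lcm0 //; first exact: perm_inj.
  have [h1 h2] := iter_layer_dcycle k v.
  have modE d (i : 'I_d) : ((val i + k) %% d == val i)%N = (d %| k)%N.
    rewrite -[X in _ == X](modn_small (ltn_ord i)) -[X in _ == X %[mod _]]addn0.
    by rewrite eqn_modDl mod0n.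
  rewrite dvdn_lcm -(modE _ v.1) -(prednK pm0) -(modE _ v.2) -h1 -h2.
  split=> [->|/andP[/eqP/val_inj e1 /eqP/val_inj e2]]; first by rewrite !eqxx.
  by rewrite [LHS]surjective_pairing e1 e2 -surjective_pairing.
rewrite (num_components_cycle_union cY).
apply/eqP; rewrite -(eqn_pmul2r lcm0) [X in _ == X]mulnC muln_lcm_gcd; apply/eqP.
rewrite fcard_order_set; first by rewrite card_prod !card_ord prednK.
- exact: perm_inj.
- by apply/fintype.subsetP => v _; rewrite inE sO.
- by move=> v w _.
Qed.

Lemma stabilization_index_dcycle n p : (0 < n)%N -> prime p ->
  is_stabilization_index (dcycle n) p (logn p n).
Proof.
move=> n0 pp; have p0 := prime_gt0 pp.
have gE m : (logn p n <= m)%N -> gcdn n (p ^ m) = (p ^ logn p n)%N.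
  have [r pr nE] := pfactor_coprime pp n0; move=> /subnKC <-.
  rewrite {1}nE expnD [(r * _)%N]mulnC -muln_gcdr.
  by have /eqP -> : coprime r (p ^ (m - logn p n)); rewrite ?muln1 // coprimeXr // coprime_sym.
split=> [m vm|m mst]; rewrite ?num_components_layer_dcycle ?gE //.
rewrite leqNgt; apply/negP => mv; have := mst _ (ltnW mv).
rewrite !num_components_layer_dcycle // gE // (gcdn_idPr _).
  by move/(expnI (prime_gt1 pp)) => vE; rewrite vE ltnn in mv.
by apply: dvdn_trans (pfactor_dvdnn p n); rewrite dvdn_exp2l // ltnW.
Qed.

(** A component is stable under the permutation, which restricts to it as a
   single cycle. *)
Lemma induced_component Y (s : {perm vert Y}) (S : {set vert Y}) :
  cycle_union s -> is_component S ->
  exists s' : {perm vert (induced S)},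
    cycle_union s' /\ forall u v, fconnect s' u v.
Proof.
move=> cY [w0 SE]; have cS := connect_cycle_union cY.
have symY := @adjacent_connect_sym Y.
have sS v : (s v \in S) = (v \in S).
  rewrite SE !inE; apply/esym/(same_connect_r symY).
  by rewrite cS fconnect1.
have sS' (v : vert (induced S)) : s (val v) \in S by rewrite sS; exact: (valP v).
pose f (v : vert (induced S)) : vert (induced S) := Sub (s (val v)) (sS' v).
have fI : injective f by move=> u v /(congr1 val) /= /perm_inj/val_inj.
exists (perm fI); case: cY => -[v2e eK vK] ts; split; first split.
- have v2eS (v : vert (induced S)) : (src (v2e (val v)) \in S) && (tgt (v2e (val v)) \in S).
    by rewrite ts vK sS andbb; exact: (valP v).
  by exists (fun v => exist _ (v2e (val v)) (v2eS v)) => [e|v]; apply: val_inj;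
    rewrite /= ?eK ?vK.
- by move=> e; apply: val_inj; rewrite permE /= ts.
- move=> u v; have wS w : w \in S -> connect (@adjacent Y) w0 w by rewrite SE inE.
  have uv : fconnect s (val u) (val v).
    rewrite -cS; apply: connect_trans (wS _ (valP v)).
    by rewrite symY; apply: wS; exact: (valP u).
  have -> : v = iter (findex s (val u) (val v)) (perm fI) u.
    apply: val_inj; rewrite -[LHS](iter_findex uv).
    by elim: (findex _ _ _) => //= k ->; rewrite permE.
  exact: fconnect_iter.
Qed.

(** * The degree on the Bowen-Franks group *)

Section Degree.
Variable Y : digraph.

Definition deg (D : Div Y) : int^o := \sum_v D v.

Fact deg_linear : linear deg.
Proof.
move=> a D E; rewrite /deg scaler_sumr -big_split.
by apply: eq_bigr => v _; rewrite !ffunE.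
Qed.
HB.instance Definition _ := GRing.isLinear.Build int (Div Y) int^o *:%R deg deg_linear.

Lemma deg_pt v : deg (pt v) = 1.
Proof.
rewrite /deg (bigD1 v) //= ffunE eqxx big1 ?addr0 // => u /negPf uv.
by rewrite ffunE uv.
Qed.

Lemma Div_pt (D : Div Y) : D = \sum_v D v *: pt v.
Proof.
apply/ffunP => w; rewrite sum_ffunE (bigD1 w) //= !ffunE eqxx big1 => [|v vw].
  by rewrite addr0; apply/esym; exact: mulr1.
by rewrite !ffunE eq_sym (negPf vw) scaler0.
Qed.

Hypothesis srcB : bijective (@src Y).

(** Each vertex is the origin of exactly one edge, so the adjacency operator carries
   each coefficient of a divisor to exactly one vertex. *)
Lemma deg_adj D : deg (adj D) = deg D.
Proof.
rewrite /deg; under eq_bigr do rewrite adjE.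
rewrite (exchange_big_dep xpredT) //= [RHS](reindex (@src Y)) /=; last exact: onW_bij.
by apply: eq_bigr => e _; rewrite (big_pred1 (tgt e)) // => w; rewrite eq_sym.
Qed.

Fact deg_one_sub_adj : {in img (@one_sub_adj Y), forall D, deg D = 0}.
Proof. by move=> _ /asboolP[D <-]; rewrite linearB /= deg_adj subrr. Qed.

Definition BFdeg : BF Y -> int^o := qlift deg_one_sub_adj.
HB.instance Definition _ := GRing.Linear.on BFdeg.

Lemma BFdeg_proj D : BFdeg (qproj D) = deg D.
Proof. exact: qlift_proj. Qed.

Variable R : comNzRingType.

Definition BFdegR (x : BF Y) : R^o := (BFdeg x)%:~R.
Fact BFdegR_zmod : zmod_morphism BFdegR.
Proof. by move=> x y; rewrite /BFdegR linearB rmorphB. Qed.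
HB.instance Definition _ := GRing.isZmodMorphism.Build (BF Y) R^o BFdegR BFdegR_zmod.

Definition BFRdeg : BFR R Y -> R^o := scalars_lift BFdegR.
HB.instance Definition _ := GRing.Linear.on BFRdeg.

Lemma BFRdeg_tens D r : BFRdeg (tens (qproj D) r) = r * (deg D)%:~R.
Proof. by rewrite /BFRdeg scalars_lift_tens /= /BFdegR BFdeg_proj. Qed.

End Degree.

Arguments BFRdeg {Y} srcB R.

Lemma deg_push (Y Z : digraph) (c : Defs.cover Y Z) D : deg (push c D) = deg D.
Proof.
rewrite /deg [RHS](partition_big c xpredT) //=.
by apply: eq_bigr => w _; rewrite ffunE.
Qed.

Lemma BFRdeg_map (R : comNzRingType) (Y Z : digraph) (c : Defs.cover Y Z)
    (hY : bijective (@src Y)) (hZ : bijective (@src Z)) x :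
  BFRdeg hZ R (BFR_map R c x) = BFRdeg hY R x.
Proof.
apply: (@BFR_ext R Y R^o (BFRdeg hZ R \o BFR_map R c) (BFRdeg hY R)) => D.
apply: etrans (congr1 (BFRdeg hZ R) (BFR_map_tens c D 1)) _.
by rewrite BFRdeg_tens deg_push; exact/esym/BFRdeg_tens.
Qed.

(** A named linear map, so that the universal property [BFR_ext] applies to its
   composites. *)
Definition scale_by (R : comNzRingType) (M : lmodType R) (t : M) (r : R^o) : M := r *: t.
Fact scale_by_linear R M t : linear (@scale_by R M t).
Proof. by move=> a x y; rewrite /scale_by scalerDl scalerA. Qed.
HB.instance Definition _ (R : comNzRingType) (M : lmodType R) (t : M) :=
  GRing.isLinear.Build R R^o M *:%R (scale_by t) (scale_by_linear t).

Lemma tens_scale_int (R : comNzRingType) (M : lmodType int) (z : int) (x : M) :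
  tens (z *: x) 1 = z%:~R *: tens x 1 :> scalars R M.
Proof.
rewrite -[z in LHS]intz !scaler_int.
exact: (raddfMz (@tens1 R M) z x).
Qed.

Section Cycle.
Variables (Y : digraph) (s : {perm vert Y}).
Hypotheses (cY : cycle_union s) (conn : forall u v, fconnect s u v).

(** The difference of the two points is the image of [pt v] under [one_sub_adj]. *)
Lemma BF_pt_next v : qproj (pt (s v)) = qproj (pt v) :> BF Y.
Proof.
apply/esym/qprojP/asboolP; exists (pt v); apply/ffunP => w.
by rewrite /one_sub_adj !ffunE (adj_pt_cycle_union _ _ cY) [w == s v]eq_sym.
Qed.

Lemma BF_pt_eq u v : qproj (pt v) = qproj (pt u) :> BF Y.
Proof.
rewrite -(iter_findex (conn u v)); elim: (findex _ _ _) => [|k IHk] //.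
by rewrite iterS; exact: etrans (BF_pt_next _) IHk.
Qed.

Lemma BF_proj_deg v D : qproj D = deg D *: qproj (pt v) :> BF Y.
Proof.
rewrite {1}[D]Div_pt linear_sum scaler_suml; apply: eq_bigr => u _.
by rewrite linearZ; congr (_ *: _); exact: BF_pt_eq.
Qed.

Variables (R : comNzRingType) (v0 : vert Y).

Definition BFR_of_deg : R^o -> BFR R Y := scale_by (tens (qproj (pt v0)) 1).
HB.instance Definition _ := GRing.Linear.on BFR_of_deg.

(** All vertices of a cycle have the same class, so the class of a divisor is its
   degree times the class of [v0]. *)
Lemma BFRdegK : cancel (BFRdeg (proj1 cY) R) BFR_of_deg.
Proof.
apply: (@BFR_ext R Y _ (BFR_of_deg \o BFRdeg (proj1 cY) R) idfun) => D.
rewrite /= BFRdeg_tens mul1r (BF_proj_deg v0 D).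
exact/esym/tens_scale_int.
Qed.

End Cycle.

(** * The augmentation ideal at finite level *)

Section Augmentation.
Variables (R : comNzRingType) (G : finZmodType).

Definition aug (a : grpring R G) : R := \sum_g a g.

Fact aug_zmod : zmod_morphism aug.
Proof. by move=> a b; rewrite /aug -sumrB; apply: eq_bigr => g _; rewrite !ffunE. Qed.
HB.instance Definition _ := GRing.isZmodMorphism.Build (grpring R G) R aug aug_zmod.

Lemma aug_const r : aug (gr_const G r) = r.
Proof.
rewrite /aug (bigD1 0) //= ffunE eqxx big1 ?addr0 // => g /negPf g0.
by rewrite ffunE g0.
Qed.

Fact aug_monoid : monoid_morphism aug.
Proof.
split=> [|a b]; first exact: aug_const.
rewrite /aug; under eq_bigr do rewrite ffunE.
rewrite exchange_big mulr_suml; apply: eq_bigr => h _ /=.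
by rewrite -mulr_sumr [in RHS](reindex_inj (addIr (- h))).
Qed.
HB.instance Definition _ := GRing.isMonoidMorphism.Build (grpring R G) R aug aug_monoid.

Lemma gr_base_mul (t g : G) (b : grpring R G) : (gr_base R t * b) g = b (g - t).
Proof.
rewrite ffunE (bigD1 t) //= ffunE eqxx mul1r big1 ?addr0 // => h /negPf ht.
by rewrite ffunE ht mul0r.
Qed.

Lemma gr_base_sub1_mul (t g : G) (b : grpring R G) :
  ((gr_base R t - 1) * b) g = b (g - t) - b g.
Proof. by rewrite mulrBl mul1r !ffunE -gr_base_mul !ffunE. Qed.

End Augmentation.

Lemma aug_map (R : comNzRingType) (G H : finZmodType) (phi : {additive G -> H})
  (a : grpring R G) : aug (gr_map phi a) = aug a.
Proof.
rewrite /aug [RHS](partition_big phi xpredT) //=.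
by apply: eq_bigr => h _; rewrite ffunE.
Qed.

Section Level.
Variables (R : comNzRingType) (p : nat).
Hypothesis p_gt0 : (0 < p)%N.

Lemma cyc_theta k (g : cyc p k) : g = theta p k *+ val g.
Proof.
have thE i : val (theta p k *+ i) = (i %% (p ^ k).-1.+1)%N.
  elim: i => [|i IHi]; first by rewrite mod0n.
  by rewrite mulrS /= IHi modnDm add1n.
by apply: val_inj; rewrite thE modn_small ?ltn_ord.
Qed.

Lemma cyc_sub_theta k (g : cyc p k) :
  val (g - theta p k) = (if val g == 0%N then (p ^ k).-1 else (val g).-1)%N.
Proof.
pose h : cyc p k := inZp (if val g == 0%N then (p ^ k).-1 else (val g).-1).
have hE : val h = (if val g == 0%N then (p ^ k).-1 else (val g).-1)%N.
  rewrite /= modn_small //; case: ifP => // _.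
  by rewrite (leq_ltn_trans (leq_pred _)) // ltn_ord.
rewrite -hE; congr val; apply/eqP; rewrite subr_eq; apply/eqP/val_inj.
rewrite [RHS]/= modnDm; case: eqP => [g0 | /eqP g0].
  by rewrite addn1 modnn; exact: g0.
by rewrite addn1 [(val g).-1.+1]prednK ?lt0n // [RHS]modn_small ?ltn_ord.
Qed.

(** The quotient by [theta - 1] is a discrete primitive, the opposite of the partial
   sums of [a] over the residues up to [g]. Wrapping around from 0 to the last
   residue is consistent because the total sum of [a] vanishes. *)
Lemma level_aug_eq0 k (a : grpring R (cyc p k)) : aug a = 0 ->
  exists b, (gr_base R (theta p k) - 1) * b = a.
Proof.
move=> a0; exists [ffun g => - \sum_(h : cyc p k | (val h <= val g)%N) a h].
apply/ffunP => g; rewrite gr_base_sub1_mul !ffunE opprK cyc_sub_theta.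
case: eqP => [g0|/eqP g0].
  rewrite (eq_bigl xpredT) => [|h]; last first.
    by rewrite -ltnS; apply: ltn_ord.
  rewrite -/(aug a) a0 oppr0 add0r (big_pred1 g) // => h.
  apply/idP/eqP => [hg|->]; last exact: leqnn.
  by apply/val_inj/eqP; rewrite eqn_leq hg [X in (X <= _)%N]g0.
rewrite (bigD1 (P := fun h : cyc p k => (val h <= val g)%N) g) //=.
rewrite addrCA [X in _ + X](_ : _ = 0) ?addr0 //.
apply/eqP; rewrite addrC subr_eq0; apply/eqP; apply: eq_bigl => h.
rewrite -(inj_eq val_inj h g) andbC -ltn_neqAle -[in RHS]ltnS.
by rewrite [(val g).-1.+1]prednK ?lt0n.
Qed.

(** As [theta] generates the group, invariance under its translation is invariance
   under all translations. *)
Lemma sub_theta_eq0 k (b : grpring R (cyc p k)) :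
  (gr_base R (theta p k) - 1) * b = 0 -> b = [ffun=> b 0].
Proof.
move=> b0; have bD g : b (g - theta p k) = b g.
  by apply/eqP; rewrite -subr_eq0 -gr_base_sub1_mul b0 ffunE.
apply/ffunP => g; rewrite ffunE (cyc_theta g).
by elim: (val g) => [|i IHi]; rewrite ?mulr0n // -IHi -bD mulrSr addrK.
Qed.

(** The fibres are translates of each other, and [p ^ k] of them partition a set
   of [p ^ k.+1] elements. *)
Lemma card_cyc_red_fibre k (h : cyc p k) : #|[pred g : cyc p k.+1 | cyc_red k g == h]| = p.
Proof.
have fE h' : #|[pred g : cyc p k.+1 | cyc_red k g == h']| =
             #|[pred g : cyc p k.+1 | cyc_red k g == 0]|.
  pose t : cyc p k.+1 := inZp (val h').
  have tE : cyc_red k t = h'.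
    by apply: val_inj; rewrite /= modn_dvdm ?cyc_dvd // modn_small.
  rewrite -[RHS](fintype.card_image (addrI t)); apply: eq_card => g; rewrite !inE.
  apply/eqP/fintype.imageP => [gh|[g' /eqP g0 ->]].
    exists (g - t); rewrite ?inE ?subrKC // raddfB /=.
    by rewrite gh tE subrr.
  by rewrite cyc_redD // tE g0 addr0.
have : #|cyc p k.+1| = (\sum_(h' : cyc p k) #|[pred g : cyc p k.+1 | cyc_red k g == h']|)%N.
  rewrite -sum1_card (partition_big (cyc_red k) xpredT) //=.
  by apply: eq_bigr => h' _; rewrite sum1_card.
under eq_bigr do rewrite fE -(fE h).
rewrite sum_nat_const !card_ord !prednK ?expn_gt0 ?p_gt0 // expnSr => /eqP.
by rewrite eqn_pmul2l ?expn_gt0 ?p_gt0 // => /eqP.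
Qed.

Lemma gr_map_cst k (c : R) :
  gr_map (@cyc_red p k.+1 k) [ffun=> c] = [ffun=> p%:R * c].
Proof.
apply/ffunP => h; rewrite !ffunE; under eq_bigr do rewrite ffunE.
by rewrite sumr_const card_cyc_red_fibre mulr_natl.
Qed.

End Level.

(** * The augmentation ideal of the Iwasawa algebra *)

Section PadicSeries.
Variable p : nat.

Lemma natr_padic (n k : nat) : (n%:R : padic p) k = n%:R.
Proof. by elim: n => // n IHn; rewrite !mulrS -IHn. Qed.

Hypothesis p_gt1 : (1 < p)%N.

(** The series with terms [p ^ i * c i], modulo [p ^ j.+1]. *)
Definition padic_series_trunc (c : nat -> padic p) (j : nat) : 'Z_(p ^ j.+1) :=
  \sum_(i < j.+1) (p ^ i)%:R * c i j.

Lemma expp_Zp0 (j : nat) : (p ^ j.+1)%:R = 0 :> 'Z_(p ^ j.+1).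
Proof. by rewrite pchar_Zp // -[1%N](expn0 p) ltn_exp2l. Qed.

Fact padic_series_compat (c : nat -> padic p) j :
  padic_red (padic_series_trunc c j.+1) = padic_series_trunc c j.
Proof.
rewrite /padic_series_trunc big_ord_recr /= rmorphD rmorph_sum rmorphM rmorph_nat.
rewrite expp_Zp0 mul0r addr0; apply: eq_bigr => i _.
by rewrite rmorphM rmorph_nat; congr (_ * _); exact: (rlimP (c i) j).
Qed.

Definition padic_series (c : nat -> padic p) : padic p :=
  @RLim (fun k => 'Z_(p ^ k.+1)) (fun k => @padic_red p k) _ (padic_series_compat c).

Lemma padic_series_rec (c : nat -> padic p) :
  padic_series c = c 0%N + p%:R * padic_series (fun i => c i.+1).
Proof.
apply: rlim_ext => j.
transitivity (c 0%N j + p%:R * padic_series_trunc (fun i => c i.+1) j); last first.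
  by rewrite -(natr_padic p j).
rewrite /= /padic_series_trunc mulr_sumr big_ord_recl expn0 mul1r; congr (_ + _).
rewrite [RHS]big_ord_recr /= mulrA -natrM -expnS expp_Zp0 mul0r addr0.
by apply: eq_bigr => i _; rewrite mulrA -natrM -expnS.
Qed.

End PadicSeries.

Section AugmentationIdeal.
Variable p : nat.
Hypothesis p_gt1 : (1 < p)%N.
Let p_gt0 : (0 < p)%N := ltnW p_gt1.

(** By [aug_level] any other level would give the same value. *)
Definition iwalg_aug (a : iwalg p) : padic p := aug (a 0%N).

Fact iwalg_aug_zmod : zmod_morphism iwalg_aug.
Proof. by move=> a b; exact: (raddfB (@aug (padic p) (cyc p 0))). Qed.
Fact iwalg_aug_monoid : monoid_morphism iwalg_aug.
Proof.
split=> [|a b]; first exact: (rmorph1 (@aug (padic p) (cyc p 0))).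
exact: (rmorphM (@aug (padic p) (cyc p 0))).
Qed.
HB.instance Definition _ :=
  GRing.isZmodMorphism.Build (iwalg p) (padic p) iwalg_aug iwalg_aug_zmod.
HB.instance Definition _ :=
  GRing.isMonoidMorphism.Build (iwalg p) (padic p) iwalg_aug iwalg_aug_monoid.

Lemma iwalg_aug_const r : iwalg_aug (iwalg_const r) = r.
Proof. exact: aug_const. Qed.

Lemma aug_level (a : iwalg p) k : aug (a k) = iwalg_aug a.
Proof. by elim: k => // k <-; rewrite -(rlimP a k) /level_red aug_map. Qed.

Lemma iwalg_T_val k : iwalg_T p k = gr_base (padic p) (theta p k) - 1.
Proof. by []. Qed.

Lemma iwalg_aug_T : iwalg_aug (iwalg_T p) = 0.
Proof.
rewrite /iwalg_aug iwalg_T_val raddfB [X in _ - X](rmorph1 (@aug _ _)).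
rewrite /= /aug (bigD1 (theta p 0)) //= ffunE eqxx.
by rewrite big1 ?addr0 ?subrr // => g /negPf gt; rewrite ffunE gt.
Qed.

Lemma iwalg_T_neq0 : iwalg_T p != 0.
Proof.
apply/eqP => /(congr1 (fun a : iwalg p => a 1%N 0)); rewrite iwalg_T_val !ffunE eqxx.
have -> : 0 == theta p 1 = false.
  by rewrite -(inj_eq val_inj) /= expn1 modn_small // prednK.
by move/eqP; rewrite sub0r oppr_eq0 oner_eq0.
Qed.

(** The quotients [b k] given by the finite levels are compatible up to constants
   [c k]; adding to them the constants [d k] makes them compatible. *)
Lemma iwalg_aug_eq0 (a : iwalg p) : iwalg_aug a = 0 -> exists b, b * iwalg_T p = a.
Proof.
move=> a0.
have ex k : exists b, (gr_base _ (theta p k) - 1) * b = a k.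
  by apply: level_aug_eq0 => //; rewrite aug_level.
pose b k : level_ring p k := projT1 (cid (ex k)).
have bE k : (gr_base _ (theta p k) - 1) * b k = a k := projT2 (cid (ex k)).
have TE k : level_red p k (gr_base _ (theta p k.+1) - 1) = gr_base _ (theta p k) - 1.
  exact: (rlimP (iwalg_T p) k).
pose c k : padic p := (level_red p k (b k.+1) - b k) 0.
have cE k : level_red p k (b k.+1) = b k + [ffun=> c k].
  apply/eqP; rewrite addrC -subr_eq; apply/eqP; apply: sub_theta_eq0 => //.
  by rewrite mulrBr bE -TE -rmorphM bE (rlimP a k) subrr.
pose d k := padic_series p_gt1 (fun i => c (k + i)%N).
have dE k : d k = c k + p%:R * d k.+1.
  rewrite /d padic_series_rec addn0; congr (_ + _ * padic_series _ _).
  by apply: funext => i; rewrite addnS.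
have b'P k : level_red p k (b k.+1 + [ffun=> d k.+1]) = b k + [ffun=> d k].
  rewrite rmorphD cE -addrA; congr (_ + _).
  by apply: etrans (congr1 _ (gr_map_cst p_gt0 k _)) _;
    apply/ffunP => g; rewrite !ffunE [RHS]dE.
exists (@RLim _ (level_red p) _ b'P); rewrite mulrC; apply: rlim_ext => k.
transitivity ((gr_base _ (theta p k) - 1) * (b k + [ffun=> d k])); first by [].
rewrite mulrDr bE -[RHS]addr0; congr (_ + _); apply/ffunP => g.
by rewrite gr_base_sub1_mul !ffunE subrr.
Qed.

End AugmentationIdeal.

(** * The limit of the Bowen-Franks modules *)

Lemma span1P (R : comNzRingType) (a v : R^o) :
  v \in Defs.span (V := R^o) (fun b => b = a) <-> exists b : R, v = b * a.
Proof.
split=> [/asboolP h|[b ->]]; last first.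
  by rewrite -[b * a]/(b *: a) rpredZ // mem_span.
apply: (h (fun w : R^o => exists b : R, w = b * a)) => [|b _ _ [u ->] [w ->]|_ ->].
- by exists 0; rewrite mul0r.
- by exists (b * u + w); rewrite mulrDl -mulrA.
- by exists 1; rewrite mul1r.
Qed.

Lemma congruent_mod_T (p : nat) (a b : iwalg p) : (1 < p)%N ->
  iwalg_aug a = iwalg_aug b -> exists c, a - b = c * iwalg_T p.
Proof.
move=> p_gt1 ab; have ab0 : iwalg_aug (a - b) = 0 by rewrite rmorphB /= ab subrr.
by have [c cE] := iwalg_aug_eq0 p_gt1 ab0; exists c.
Qed.

Section Levels.
Variables (X : digraph) (p m0 : nat) (s : {perm vert X}).
Variable C : {set vert (layer X p m0)}.
Hypothesis cX : cycle_union s.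
Hypothesis C_above : forall k, is_component (above_set C k).
Hypothesis p_gt1 : (1 < p)%N.

Lemma above_cycle k : exists s' : {perm vert (above C k)},
  cycle_union s' /\ forall u v, fconnect s' u v.
Proof. exact: induced_component (layer_cycle_union p _ cX) (C_above k). Qed.

Lemma above_src_bij k : bijective (@src (above C k)).
Proof. by have [s' [[]]] := above_cycle k. Qed.

Definition level_deg k : level_mod C k -> padic p := BFRdeg (above_src_bij k) (padic p).

Lemma level_degD k : {morph @level_deg k : x y / x + y}.
Proof. by move=> x y; exact: (linearD (BFRdeg (above_src_bij k) (padic p))). Qed.

Lemma level_deg_inj k : injective (@level_deg k).
Proof.
have [s' [cY conn]] := above_cycle k; have [w0 CE] := C_above k.
have w0C : w0 \in above_set C k by rewrite CE inE connect0.
have := can_inj (BFRdegK (R := padic p) cY conn (exist _ w0 w0C : vert (above C k))).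
rewrite /level_deg; congr (injective (BFRdeg _ _)); exact: Prop_irrelevance.
Qed.

Lemma level_deg_surj k (r : padic p) : exists x, @level_deg k x = r.
Proof.
have [w0 CE] := C_above k.
have w0C : w0 \in above_set C k by rewrite CE inE connect0.
exists (tens (qproj (pt (exist _ w0 w0C : vert (above C k)))) r).
by rewrite /level_deg BFRdeg_tens deg_pt mulr1.
Qed.

(** Deck transformations preserve the degree, so only the sum of the coefficients
   of [a] matters. *)
Lemma level_degZ k (a : level_ring p k) (x : level_mod C k) :
  level_deg (a *: x) = aug a * level_deg x.
Proof.
rewrite /aug mulr_suml /level_deg.
transitivity (\sum_g BFRdeg (above_src_bij k) (padic p) (a g *: deck_action C k g x)).
  exact: (linear_sum (BFRdeg (above_src_bij k) (padic p))).
apply: eq_bigr => g _.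
apply: etrans (linearZ_LR (BFRdeg (above_src_bij k) (padic p)) _ _) (congr1 _ _).
exact: BFRdeg_map.
Qed.

Lemma level_deg_map k (x : level_mod C k.+1) : level_deg (level_map C k x) = level_deg x.
Proof. exact: BFRdeg_map. Qed.

Definition infty_deg (x : BF_infty C) : padic p := level_deg (x 0%N).

Lemma infty_degE (x : BF_infty C) k : level_deg (x k) = infty_deg x.
Proof.
by elim: k => // k <-; rewrite -level_deg_map; congr level_deg; exact: (mlimP x k).
Qed.

Lemma infty_deg_inj : injective infty_deg.
Proof.
by move=> x y xy; apply: mlim_ext => k; apply: level_deg_inj; rewrite !infty_degE.
Qed.

Lemma infty_degD : {morph infty_deg : x y / x + y}.
Proof. by move=> x y; exact: level_degD. Qed.

Lemma infty_degZ (a : iwalg p) x : infty_deg (a *: x) = iwalg_aug a * infty_deg x.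
Proof. exact: level_degZ. Qed.

Lemma infty_deg_surj r : exists x, infty_deg x = r.
Proof.
pose x k := projT1 (cid (level_deg_surj k r)).
have xE k : level_deg (x k) = r := projT2 (cid (level_deg_surj k r)).
have xP k : level_map C k (x k.+1) = x k.
  by apply: level_deg_inj; rewrite level_deg_map !xE.
by exists (MLim (@level_mapZ _ _ _ C) xP); exact: xE.
Qed.

Lemma infty_finitely_generated : finitely_generated (BF_infty C).
Proof.
have [e e1] := infty_deg_surj 1; exists [:: e] => x.
exists (fun=> iwalg_const (infty_deg x)).
rewrite big_ord1 /=; apply: infty_deg_inj.
by rewrite infty_degZ e1 mulr1 iwalg_aug_const.
Qed.

Lemma infty_torsion : torsion_mod (BF_infty C).
Proof.
move=> x; exists (iwalg_T p); first exact: iwalg_T_neq0.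
apply: infty_deg_inj; rewrite infty_degZ iwalg_aug_T mul0r.
by apply/esym/(addrI (infty_deg 0)); rewrite -infty_degD !addr0.
Qed.

Local Notation N := (elementary_mod [::] [:: 'X : {poly padic p}]).
Local Notation rels := ([seq iwalg_eval f | f <- [:: 'X : {poly padic p}]]).

Lemma iwalg_evalX : iwalg_eval 'X = iwalg_T p.
Proof. by rewrite /iwalg_eval map_polyX hornerX. Qed.

(** The index type of the direct sum reduces to ['I_1], and the degree is read as a
   constant of the Iwasawa algebra modulo [T]. *)
Definition infty_iso (x : BF_infty C) : N :=
  fun i : 'I_1 => qproj (iwalg_const (infty_deg x) : (iwalg p)^o) : cyclic_mod rels`_i.

Lemma rels_nth (i : 'I_1) : rels`_i = iwalg_T p.
Proof. by rewrite ord1 /= iwalg_evalX. Qed.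

(** The Iwasawa algebra acts through the augmentation on both sides: on degrees by
   [infty_degZ], and modulo [T] by [congruent_mod_T]. *)
Fact infty_iso_linear : linear infty_iso.
Proof.
move=> a x y; apply: functional_extensionality_dep => i.
transitivity (a *: (qproj (iwalg_const (infty_deg x) : (iwalg p)^o) : cyclic_mod rels`_i)
  + qproj (iwalg_const (infty_deg y) : (iwalg p)^o)); last by [].
rewrite -linearP; apply/qprojP; apply/span1P; rewrite rels_nth.
apply: congruent_mod_T => //.
transitivity (iwalg_aug (a * iwalg_const (infty_deg x) + iwalg_const (infty_deg y))) => //.
have -> : infty_deg (a *: x + y) = iwalg_aug a * infty_deg x + infty_deg y.
  exact: etrans (infty_degD _ _) (congr1 (+%R^~ _) (infty_degZ _ _)).
move: (infty_deg x) (infty_deg y) => r t.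
rewrite iwalg_aug_const (rmorphD (@iwalg_aug p)) (rmorphM (@iwalg_aug p)) /=.
by rewrite !iwalg_aug_const.
Qed.
HB.instance Definition _ := GRing.isLinear.Build (iwalg p) (BF_infty C) N *:%R
  infty_iso infty_iso_linear.

Lemma infty_iso_inj x : infty_iso x = 0 -> x = 0.
Proof.
move=> /(congr1 (fun f : N => f ord0)) x0.
have : qproj (iwalg_const (infty_deg x) : (iwalg p)^o) = 0 :> cyclic_mod rels`_(ord0 : 'I_1).
  exact: x0.
move/qproj_eq0/span1P => [b]; rewrite rels_nth => /(congr1 (@iwalg_aug p)).
rewrite iwalg_aug_const rmorphM /= iwalg_aug_T mulr0 => d0.
apply: infty_deg_inj; rewrite d0.
by apply: (addrI (infty_deg 0)); rewrite -infty_degD !addr0.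
Qed.

Lemma infty_iso_surj (y : N) : exists x, infty_iso x = y.
Proof.
have [v vE] : exists v : (iwalg p)^o, y = (fun i : 'I_1 => qproj v : cyclic_mod rels`_i).
  exists (qrepr (y ord0)); apply: functional_extensionality_dep => i.
  by rewrite (ord1 i) qreprK.
have [x xE] := infty_deg_surj (iwalg_aug v); exists x; rewrite vE.
apply: functional_extensionality_dep => i; apply/qprojP/span1P; rewrite rels_nth xE.
exact/congruent_mod_T/iwalg_aug_const.
Qed.

Lemma infty_pseudo_isomorphic : pseudo_isomorphic (BF_infty C) N.
Proof.
exists infty_iso; split.
  rewrite (_ : mkset _ = [set 0]) ?finite_set1 //.
  by apply/seteqP; split=> x /= => [/infty_iso_inj | ->]; rewrite ?linear0.
rewrite (_ : setT = [set 0]) ?finite_set1 //.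
apply/seteqP; split=> z //= _; rewrite -[z]qreprK.
apply/qproj_eq0/asboolP; have [x xE] := infty_iso_surj (qrepr z).
by exists x.
Qed.

Lemma infty_invariants : iwasawa_invariants (BF_infty C) 0 1.
Proof.
split; [exact: infty_finitely_generated | exact: infty_torsion |].
exists [::], [:: 'X]; split=> //; rewrite ?big_nil ?big_seq1 ?size_polyX //.
  move=> f; rewrite inE => /eqP ->; split; first exact: monicX.
  by move=> i; rewrite size_polyX coefX; case: i => // _; exists 0; rewrite mulr0.
exact: infty_pseudo_isomorphic.
Qed.

End Levels.

Lemma infinite_BF (Y : digraph) (v : vert Y) :
  bijective (@src Y) -> infinite_set [set: BF Y].
Proof.
move=> srcB fin; apply: infinite_nat.
have := finite_image (fun x : BF Y => absz (BFdeg srcB x)) fin.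
congr finite_set; apply/seteqP; split=> k //= _.
exists (qproj (k%:Z *: pt v)) => //.
by rewrite BFdeg_proj linearZ /= deg_pt [_ *: _]mulr1.
Qed.

(** * The directed cycle *)

Theorem theorem3p1 (n : nat) (hn : (1 <= n)%N) :
  infinite_set [set: BF (dcycle n)] /\
  defect (dcycle n) = 0 /\
  forall p : nat, prime p ->
    (forall m : nat, defect (layer (dcycle n) p m) = 0) /\
    exists m0 : nat,
      is_stabilization_index (dcycle n) p m0 /\
      forall C : {set vert (layer (dcycle n) p m0)}, is_component C ->
        iwasawa_invariants (BF_infty C) 0 1.
Proof.
have cX := dcycle_cycle_union n.
split; first exact: infinite_BF (Ordinal hn : vert (dcycle n)) (proj1 cX).
split; first exact: defect_cycle_union cX.
move=> p pp; split=> [m|]; first exact: defect_cycle_union (layer_cycle_union p m cX).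
have st := stabilization_index_dcycle hn pp.
exists (logn p n); split=> // C cC.
apply: infty_invariants cX _ (prime_gt1 pp) => k.
by apply: above_component => //; case: st.
Qed.
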